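(* Let $\Omega\subset\mathbb{R}^2$ be a domain, let $f\in L^\infty(\Omega)$, let $u_0$ be the trace of a fixed function in $H^1(\Omega;\mathbb{R}^2)$, and set $$F(u):=\int_\Omega |\nabla u|^2+f(x)\det\nabla u\,dx,\qquad \mathbb{D}(u):=\int_\Omega|\nabla u|^2\,dx .$$ Assume that there exists $\gamma>0$, depending only on $f$ and $\Omega$, such that $$F(\varphi)\ge\gamma\int_\Omega|\nabla\varphi|^2\,dx\qquad\text{for all }\varphi\in H^1_0(\Omega;\mathbb{R}^2).$$ Let $u$ minimize $F$ in $H^1_{u_0}(\Omega;\mathbb{R}^2)$. Then $u$ is the unique minimizer of $\mathbb{D}$ in the class $$\mathcal{A}_g:=\{v\in H^1_{u_0}(\Omega;\mathbb{R}^2):\ \det\nabla v=g\ \text{a.e. in }\Omega\},\qquad\text{where } g:=\det\nabla u .$$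
   Context: $H^1_{u_0}(\Omega;\mathbb{R}^2)=\{v\in H^1(\Omega;\mathbb{R}^2): v=u_0 \text{ on }\partial\Omega\}$, where equality on $\partial\Omega$ is in the sense of traces, i.e. $v$ differs from the fixed $H^1$ function with trace $u_0$ by an element of $H^1_0(\Omega;\mathbb{R}^2)$. $|\cdot|$ is the Frobenius norm on matrices. Maps are identified when equal a.e. *)

(* Defs.v *)
From HB Require Import structures.
From mathcomp Require Import all_boot all_order all_algebra.
From mathcomp Require Import all_classical all_reals all_analysis.

Set Implicit Arguments.
Unset Strict Implicit.
Unset Printing Implicit Defensive.
Import Order.TTheory GRing.Theory Num.Theory.
Import numFieldNormedType.Exports.

Local Open Scope classical_set_scope.
Local Open Scope ring_scope.

Section Sobolev.
Context {R : realType}.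

(* The plane is [R * R], with its Borel sigma-algebra; every Lebesgue
   measurable function has a Borel representative in its a.e. class. *)
Definition area : set (measurableTypeR R * measurableTypeR R) -> \bar R :=
  (@lebesgue_measure R \x @lebesgue_measure R)%E.

Definition domain (Omega : set (R * R)) : Prop :=
  [/\ Omega !=set0, open Omega & connected Omega].

(* Functions are total on the plane; only their values on [Omega] matter, and
   [f \_ Omega] is [f] extended by zero outside [Omega]. *)
Definition Lp_on (p : \bar R) (Omega : set (R * R)) (f : R * R -> R) : Prop :=
  (f \_ Omega : measurableTypeR R * measurableTypeR R -> R) \in Lfun area p.

Definition basis_vec (j : 'I_2) : R * R := if j == 0 then (1, 0) else (0, 1).

Definition partial (j : 'I_2) (phi : R * R -> R) : R * R -> R :=
  fun x => 'D_(basis_vec j) phi x.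

Definition smooth (phi : R * R -> R) : Prop :=
  forall s : seq 'I_2,
    continuous (foldr partial phi s) /\
    forall (j : 'I_2) (x : R * R), derivable (foldr partial phi s) x (basis_vec j).

Definition test_function (Omega : set (R * R)) (phi : R * R -> R) : Prop :=
  [/\ smooth phi,
      compact (closure [set x | phi x != 0]) &
      closure [set x | phi x != 0] `<=` Omega].

Definition is_weak_partial (Omega : set (R * R)) (j : 'I_2)
    (u g : R * R -> R) : Prop :=
  forall phi, test_function Omega phi ->
    \int[area]_(x in Omega) (u x * partial j phi x)
    = - \int[area]_(x in Omega) (g x * phi x).

Definition L2_weak_partials (Omega : set (R * R)) (j : 'I_2) (u : R * R -> R) :
    set (R * R -> R) :=
  [set g | Lp_on 2%:E Omega g /\ is_weak_partial Omega j u g].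

(* A representative of the weak derivative, which is unique up to a.e. equality
   in [Omega]. *)
Definition weak_partial (Omega : set (R * R)) (j : 'I_2) (u : R * R -> R) :
    R * R -> R :=
  xget (cst 0) (L2_weak_partials Omega j u).

Definition component (i : 'I_2) (u : R * R -> 'cV[R]_2) : R * R -> R :=
  fun x => u x i 0.

Definition H1 (Omega : set (R * R)) : set (R * R -> 'cV[R]_2) :=
  [set u | forall i : 'I_2, Lp_on 2%:E Omega (component i u) /\
           forall j : 'I_2, L2_weak_partials Omega j (component i u) !=set0].

Definition wgrad (Omega : set (R * R)) (u : R * R -> 'cV[R]_2) (x : R * R) :
    'M[R]_2 :=
  \matrix_(i < 2, j < 2) weak_partial Omega j (component i u) x.

(* Squared Frobenius norm. *)
Definition frob2 (m n : nat) (A : 'M[R]_(m, n)) : R :=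
  \sum_(i < m) \sum_(j < n) A i j ^+ 2.

Definition H1norm (Omega : set (R * R)) (u : R * R -> 'cV[R]_2) : R :=
  Num.sqrt (\int[area]_(x in Omega) (frob2 (u x) + frob2 (wgrad Omega u x))).

(* The closure of the test functions in [H1]. *)
Definition H10 (Omega : set (R * R)) : set (R * R -> 'cV[R]_2) :=
  [set w | H1 Omega w /\
    forall e : R, 0 < e ->
      exists phi : R * R -> 'cV[R]_2,
        (forall i : 'I_2, test_function Omega (component i phi)) /\
        H1norm Omega (fun x => w x - phi x) < e].

Definition H1bc (Omega : set (R * R)) (u0 : R * R -> 'cV[R]_2) :
    set (R * R -> 'cV[R]_2) :=
  [set v | H1 Omega v /\ H10 Omega (fun x => v x - u0 x)].

Definition energyF (Omega : set (R * R)) (f : R * R -> R)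
    (u : R * R -> 'cV[R]_2) : R :=
  \int[area]_(x in Omega)
    (frob2 (wgrad Omega u x) + f x * \det (wgrad Omega u x)).

Definition dirichlet (Omega : set (R * R)) (u : R * R -> 'cV[R]_2) : R :=
  \int[area]_(x in Omega) frob2 (wgrad Omega u x).

Definition prescribed_det (Omega : set (R * R)) (u0 : R * R -> 'cV[R]_2)
    (g : R * R -> R) : set (R * R -> 'cV[R]_2) :=
  [set v | H1bc Omega u0 v /\
    {ae area, forall x, Omega x -> \det (wgrad Omega v x) = g x}].

Definition minimizes (T : Type) (J : T -> R) (A : set T) (u : T) : Prop :=
  A u /\ forall v, A v -> J u <= J v.

End Sobolev.

(* Main.v *)
Require Import Defs.
From HB Require Import structures.
From mathcomp Require Import all_boot all_order all_algebra.
From mathcomp Require Import all_classical all_reals all_analysis.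
From mathcomp Require Import measurable_realfun ess_sup_inf ring lra.
Import Order.TTheory GRing.Theory Num.Theory.
Import numFieldNormedType.Exports.

Local Open Scope classical_set_scope.
Local Open Scope ring_scope.

Set Implicit Arguments.
Unset Strict Implicit.
Unset Printing Implicit Defensive.

(** The functional [energyF] differs from [dirichlet] by the integral of
    [f * det], so on the class where the determinant is prescribed almost
    everywhere the two functionals differ by a constant.  A minimizer [u] of
    [energyF] among all admissible maps, which lies in that class, therefore
    also minimizes [dirichlet] there ([energyF_sub_dirichlet]).

    For uniqueness, let [v] be another minimizer; then [energyF v] is also
    equal to [energyF u].  The functional [energyF] is a quadratic form, so
    the parallelogram identity ([energyF_parallelogram]) applied to [u] and
    [v] reads
      [energyF ((v + u) / 2) + energyF ((v - u) / 2) = energyF u].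
    The mean of [u] and [v] is admissible, hence its energy is at least
    [energyF u], and [energyF ((v - u) / 2) <= 0].  Since [(v - u) / 2] is in
    [H10], coercivity forces its gradient to vanish almost everywhere.

    It remains to see that a map [w] of [H10] whose gradient vanishes is zero,
    on a domain that may be unbounded, where the Poincare inequality may fail
    ([H10_wgrad0_ae0]).  For a test function [phi], the integral over the
    domain of the derivative of [phi ^ 2 * atan x] in the first coordinate [x]
    is zero; this bounds the integral of [phi ^ 2 / (1 + x ^ 2)] by a constant
    times the product of the norms of [phi] and of its first partial
    derivative ([test_weighted_bound]).  Along test functions converging to
    [w], the former norm stays bounded and the latter tends to zero.

    All of this needs weak gradients to depend linearly on the map, that is,
    weak derivatives to be unique almost everywhere.  This is the fundamental
    lemma of the calculus of variations ([test_orthogonal_ae0]): products of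
    functions built from [exp (- 1 / x)] are test functions that converge
    boundedly to indicators of rectangles, and the Dynkin system generated by
    rectangles is the whole Borel sigma-algebra of the plane.  That
    classical derivatives of test functions are weak derivatives, and the
    estimate with [atan], both come from one integration by parts
    ([integral_by_parts]), proved with Fubini and the fundamental theorem of
    calculus on lines. *)

(** * Rectangles and Borel sets of the plane *)

Section plane.
Context {R : realType}.
Local Notation plane := (measurableTypeR R * measurableTypeR R)%type.

Definition rect (a b c d : R) : set (R * R) := `]a, b[ `*` `]c, d[.

Lemma measurable_rect a b c d : measurable (rect a b c d : set plane).
Proof. by apply: measurableX; exact: measurable_itv. Qed.

Lemma rectI a b c d a' b' c' d' :
  rect a b c d `&` rect a' b' c' d' =
  rect (Num.max a a') (Num.min b b') (Num.max c c') (Num.min d d').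
Proof.
apply/seteqP; split=> -[x y]; rewrite /rect /= !in_itv/= !gt_max !lt_min.
  by move=> [[/andP[-> ->] /andP[-> ->]] [/andP[-> ->] /andP[-> ->]]].
by move=> [/andP[/andP[-> ->] /andP[-> ->]] /andP[/andP[-> ->] /andP[-> ->]]].
Qed.

Definition crect (a b c d : R) : set (R * R) := `[a, b] `*` `[c, d].

Lemma measurable_crect a b c d : measurable (crect a b c d : set plane).
Proof. by apply: measurableX; exact: measurable_itv. Qed.

Lemma compact_crect a b c d : compact (crect a b c d).
Proof. by apply: compact_setX; exact: segment_compact. Qed.

Lemma closed_crect a b c d : closed (crect a b c d).
Proof. by apply: compact_closed; [exact: norm_hausdorff|exact: compact_crect]. Qed.

Lemma rect_sub_crect a b c d : rect a b c d `<=` crect a b c d.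
Proof. by move=> x [/= h1 h2]; split; exact: subset_itv_oo_cc. Qed.

Lemma crectS a b c d a' b' c' d' : a <= a' -> b' <= b -> c <= c' -> d' <= d ->
  crect a' b' c' d' `<=` crect a b c d.
Proof.
move=> aa' b'b cc' d'd [x y]; rewrite /crect/= !in_itv/=.
by move=> [/andP[? ?] /andP[? ?]]; split; apply/andP; split; lra.
Qed.

Lemma area_crect_lty a b c d : (@area R (crect a b c d) < +oo)%E.
Proof.
rewrite /area product_measure1E; [|exact: measurable_itv..].
have itv_lty (x y : R) : (@lebesgue_measure R `[x, y] < +oo)%E.
  by rewrite lebesgue_measure_itv; case: ifP => _ //; rewrite ltry.
by apply: lte_mul_pinfty; rewrite ?ge0_fin_numE//; exact: itv_lty.
Qed.

Definition rat_rect (q : rat * rat * (rat * rat)) : set (R * R) :=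
  rect (ratr q.1.1) (ratr q.1.2) (ratr q.2.1) (ratr q.2.2).

Definition closed_rat_rect (q : rat * rat * (rat * rat)) : set (R * R) :=
  crect (ratr q.1.1) (ratr q.1.2) (ratr q.2.1) (ratr q.2.2).

(** The closed rectangles are required to lie in [A] because test functions
    associated with a rectangle are supported in its closure. *)
Lemma open_bigcup_rat_rect (A : set (R * R)) : open A ->
  A = \bigcup_(q in [set q | closed_rat_rect q `<=` A]) rat_rect q.
Proof.
move=> oA; apply/seteqP; split=> [[x y] Axy|[x y] [q qA qxy]]; last first.
  by apply: qA; exact: rect_sub_crect.
have /nbhs_ballP [e /= e0 eA] : nbhs (x, y) A by exact: open_nbhs_nbhs.
have [a] := @rat_in_itvoo R (x - e) x ltac:(lra).
have [b] := @rat_in_itvoo R x (x + e) ltac:(lra).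
have [c] := @rat_in_itvoo R (y - e) y ltac:(lra).
have [d] := @rat_in_itvoo R y (y + e) ltac:(lra).
rewrite !in_itv/= => /andP[yd dy] /andP[cy yc] /andP[xb bx] /andP[ax xa].
exists ((a, b), (c, d)); last by rewrite /rat_rect/rect/= !in_itv/= xa xb yc yd.
move=> [s t]; rewrite /closed_rat_rect/crect/= !in_itv/= => -[/andP[as_ sb] /andP[ct td]].
apply: eA; split; rewrite /ball/= ltr_norml; apply/andP; split; lra.
Qed.

Lemma open_measurable_plane (A : set (R * R)) : open A -> measurable (A : set plane).
Proof.
move=> /open_bigcup_rat_rect ->.
rewrite bigcup_mkcond; apply: countable_bigcupT_measurable => [|q].
  exact: countableP.
by case: ifP => // _; exact: measurable_rect.
Qed.

Lemma continuous_measurable_plane (f : R * R -> R) (D : set (R * R)) :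
  measurable (D : set plane) -> continuous f ->
  measurable_fun D (f : plane -> R).
Proof.
move=> mD cf; apply: (@measurable_funS _ _ _ _ setT) => //.
apply: (measurability _ (RGenOpens.measurableE R)).
move=> _ [_ [a [b ->] <-]]; rewrite setTI; apply: open_measurable_plane.
by move/continuousP: cf; apply; exact: interval_open.
Qed.

Definition rects : set (set plane) :=
  [set A | exists a b c d, A = rect a b c d].

(** Rectangles are stable under intersection, so this presentation makes
    Dynkin induction on rectangles available. *)
Lemma measurable_plane : @measurable _ plane = <<s rects >>.
Proof.
apply/seteqP; split; last first.
  apply: smallest_sub; first exact: sigma_algebra_measurable.
  by move=> _ [a [b [c [d ->]]]]; exact: measurable_rect.
apply: smallest_sub; first exact: smallest_sigma_algebra.
have mrect a b c d : <<s rects >> (rect a b c d).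
  by apply: sub_sigma_algebra; exists a, b, c, d.
have m1 : measurable_fun setT (fst : g_sigma_algebraType rects -> R).
  apply: (measurability _ (RGenOpens.measurableE R)).
  move=> _ [_ [a [b ->] <-]]; rewrite setTI.
  (* strips are countable unions of bounded rectangles *)
  have -> : fst @^-1` `]a, b[ = \bigcup_n rect a b (- n%:R) n%:R.
    apply/seteqP; split => [[x y]/= xab|[x y] [n _ []]//].
    exists (Num.truncn `|y|).+1 => //.
    have := truncnS_gt `|y|; rewrite ltr_norml => /andP[y1 y2].
    by split=> //=; rewrite in_itv/= y1.
  by apply: bigcupT_measurable => n; exact: mrect.
have m2 : measurable_fun setT (snd : g_sigma_algebraType rects -> R).
  apply: (measurability _ (RGenOpens.measurableE R)).
  move=> _ [_ [a [b ->] <-]]; rewrite setTI.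
  have -> : snd @^-1` `]a, b[ = \bigcup_n rect (- n%:R) n%:R a b.
    apply/seteqP; split => [[x y]/= yab|[x y] [n _ []]//].
    exists (Num.truncn `|x|).+1 => //.
    have := truncnS_gt `|x|; rewrite ltr_norml => /andP[x1 x2].
    by split=> //=; rewrite in_itv/= x1.
  by apply: bigcupT_measurable => n; exact: mrect.
rewrite subUset; split => _ [X mX <-].
  exact: m1.
exact: m2.
Qed.

End plane.

(** * The functions [P (1 / x) * exp (- 1 / x)] *)

Section flat_functions.
Context {R : realType}.
Implicit Types (P : {poly R}) (x t : R).

Lemma exprn_le_fact_expR (i : nat) t : 0 <= t -> t ^+ i <= i`!%:R * expR t.
Proof.
move=> t0; case: i => [|i].
  by rewrite expr0 mul1r -expR0 ler_expR.
rewrite mulrC -ler_pdivrMr ?ltr0n ?fact_gt0//.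
by apply: le_trans (expR_ge1Dxn i t0); rewrite lerDr.
Qed.

Lemma horner_le_expR P : exists2 C, 0 <= C &
  forall t, 0 <= t -> `|P.[t]| <= C * expR t.
Proof.
exists (\sum_(i < size P) `|P`_i| * i`!%:R).
  by apply: sumr_ge0 => i _; rewrite mulr_ge0.
move=> t t0; rewrite horner_coef mulr_suml.
apply: le_trans (ler_norm_sum _ _ _) _; apply: ler_sum => i _.
rewrite normrM -mulrA ler_wpM2l// ger0_norm ?exprn_ge0//.
exact: exprn_le_fact_expR.
Qed.

(** With [P = 1] this is the usual smooth function that vanishes to infinite
    order at [0]; an arbitrary polynomial factor makes the family closed under
    differentiation, so that smoothness needs no formula for higher
    derivatives. *)
Definition flat P x : R := if 0 < x then P.[x^-1] * expR (- x^-1) else 0.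

(** The exponential beats every polynomial in [1 / x]; quadratic decay at [0]
    is what makes the derivative exist and vanish there. *)
Lemma flat_quadratic P : exists2 C, 0 <= C & forall x, `|flat P x| <= C * x ^+ 2.
Proof.
have [C C0 hC] := horner_le_expR (P * 'X^2); exists C => // x.
rewrite /flat; case: ifPn => x0; last by rewrite normr0 mulr_ge0// sqr_ge0.
have := hC x^-1; rewrite invr_ge0 => /(_ (ltW x0)).
rewrite hornerM hornerXn normrM.
rewrite (ger0_norm (exprn_ge0 _ _)) ?invr_ge0 ?(ltW x0)// => h.
rewrite normrM (ger0_norm (expR_ge0 _)) expRN ler_pdivrMr ?expR_gt0//.
have -> : `|P.[x^-1]| = `|P.[x^-1]| * x^-1 ^+ 2 * x ^+ 2.
  by rewrite -mulrA -exprMn mulVf ?gt_eqF// expr1n mulr1.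
by rewrite [leRHS]mulrAC ler_wpM2r// exprn_ge0// ltW.
Qed.

(** Differentiating [P (1 / x) * exp (- 1 / x)] produces the factor
    [1 / x ^ 2] in both terms of the product rule. *)
Definition dflat P : {poly R} := 'X^2 * (P - P^`()).

Lemma is_derive_flat P x : is_derive x 1 (flat P) (flat (dflat P) x).
Proof.
have [x0|x0|->] := ltgtP x 0.
- rewrite {2}/flat ltNge (ltW x0)/=.
  apply: (@near_eq_is_derive _ _ _ (cst 0)).
  by near=> y; rewrite /flat ltNge ltW//; near: y; exact: lt_nbhsl.
- pose g := fun y : R => P.[y^-1] * expR (- y^-1).
  apply: (@near_eq_is_derive _ _ _ g).
    by near=> y; rewrite /flat/g ifT//; near: y; exact: lt_nbhsr.
  have xn0 : x != 0 by rewrite gt_eqF.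
  have dV : is_derive x 1 (fun y : R => y^-1) (- x ^- 2).
    have := is_deriveV xn0 (is_derive_id x 1).
    by rewrite /GRing.scale/= mulr1.
  have d1 := @is_derive1_comp R (horner P) (fun y : R => y^-1) x _ _ (is_derive_poly _ _) dV.
  have dN := @is_deriveN _ _ _ _ _ _ _ dV.
  have d2 := @is_derive1_comp R expR (fun y : R => - y^-1) x _ _ (is_derive_expR _) dN.
  have := @is_deriveM _ _ _ _ _ _ _ _ d1 d2.
  rewrite /flat x0 /dflat => h; apply: is_derive_eq.
  rewrite /= !hornerE /GRing.scale/= exprVn; ring.
- rewrite {2}/flat ltxx.
  have [C C0 hC] := flat_quadratic P.
  have f0 : flat P 0 = 0 by rewrite /flat ltxx.
  suff h : (fun h : R => h^-1 *: (flat P (h *: 1 + 0) - flat P 0)) @ 0^' --> (0:R).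
    by split; [apply/cvg_ex; exists 0|apply/cvg_lim].
  apply/cvgr0Pnorm_le => e e0.
  have Ce : 0 < C + 1 by rewrite ltr_wpDl.
  near=> h; rewrite f0 subr0 addr0.
  have hn0 : h != 0 by near: h; exact: nbhs_dnbhs_neq.
  have he : `|h| <= e / (C + 1).
    near: h; apply: dnbhs0_le; exact: divr_gt0.
  rewrite normrZ normfV ler_pdivrMl ?normr_gt0//.
  have -> : h *: (1:R) = h by rewrite /GRing.scale/= mulr1.
  apply: le_trans (hC h) _.
  rewrite -real_normK ?num_real// expr2 mulrCA ler_wpM2l//.
  rewrite (le_trans _ (_ : (C + 1) * `|h| <= e))//.
    by rewrite ler_wpM2r// lerDl.
  by rewrite mulrC -ler_pdivlMr.
Unshelve. all: by end_near.
Qed.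

End flat_functions.

(** * Partial derivatives along lines, and tensor products *)

Section lines.
Context {R : realType}.
Implicit Types (j : 'I_2) (p : R * R) (phi : R * R -> R).

Definition coord j p : R := if j == 0 then p.1 else p.2.

Definition line j p (s : R) : R * R := if j == 0 then (s, p.2) else (p.1, s).

Lemma line_coord j p : line j p (coord j p) = p.
Proof. by rewrite /line/coord; case: p => a b; case: (j == 0). Qed.

Lemma line_line j p s t : line j (line j p s) t = line j p t.
Proof. by rewrite /line; case: (j == 0). Qed.

Lemma coord_line j p s : coord j (line j p s) = s.
Proof. by rewrite /line/coord; case: (j == 0). Qed.

Lemma shift_line j p (h : R) :
  h *: basis_vec j + p = line j p (h *: 1 + coord j p).
Proof.
rewrite /line/coord/basis_vec; case: ifP => _; case: p => a b /=;
  congr pair; rewrite /= ?scaler0 ?add0r//.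
Qed.

(** Partial derivatives are derivatives of restrictions to lines: the two
    difference quotients are the same function. *)
Lemma growth_line j phi p :
  (fun h : R => h^-1 *: (phi (h *: basis_vec j + p) - phi p)) =
  (fun h : R => h^-1 *: ((phi \o line j p) (h *: 1 + coord j p)
                         - (phi \o line j p) (coord j p))).
Proof. by apply/funext => h; rewrite /= -shift_line line_coord. Qed.

Lemma derivable_line j phi p :
  derivable phi p (basis_vec j) = derivable (phi \o line j p) (coord j p) 1.
Proof. by rewrite /derivable growth_line. Qed.

Lemma partial_line j phi p : partial j phi p = 'D_1 (phi \o line j p) (coord j p).
Proof. by rewrite /partial /derive growth_line. Qed.

Lemma is_derive_line j phi p l :
  is_derive (coord j p) 1 (phi \o line j p) l ->
  derivable phi p (basis_vec j) /\ partial j phi p = l.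
Proof. by rewrite derivable_line partial_line => -[]. Qed.

End lines.

Section smooth_class.
Context {R : realType}.

(** A class of smooth functions of one variable described by its generators:
    closure under differentiation is then a plain induction. *)
Inductive flat_algebra : (R -> R) -> Prop :=
| FlatGen P a b : flat_algebra (fun x => flat P (a * x + b))
| FlatAdd f g : flat_algebra f -> flat_algebra g -> flat_algebra (f \+ g)
| FlatMul f g : flat_algebra f -> flat_algebra g -> flat_algebra (f \* g).

Lemma flatZ (c : R) P : flat (c *: P) = c \*o flat P.
Proof.
by apply/funext => x; rewrite /flat/=; case: ifP; rewrite ?mulr0// hornerZ mulrA.
Qed.

Lemma flat_algebra_derive f : flat_algebra f ->
  exists2 g, flat_algebra g & forall x : R, is_derive x 1 f (g x).
Proof.
elim=> [P a b|{}f g _ [f' Ff' df] _ [g' Fg' dg]|{}f g Ff [f' Ff' df] Fg [g' Fg' dg]].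
- exists (fun x => flat (a *: dflat P) (a * x + b)); first exact: FlatGen.
  move=> x; rewrite flatZ/=.
  have dab : is_derive x 1 (fun y : R => a * y + b) a.
    by apply: is_derive_eq; rewrite /GRing.scale/=; ring.
  have := @is_derive1_comp R (flat P) (fun y => a * y + b) x _ _ (is_derive_flat P _) dab.
  by rewrite mulrC.
- by exists (f' \+ g'); [exact: FlatAdd|move=> x; exact: is_deriveD].
- exists ((f \* g') \+ (g \* f')).
    by apply: FlatAdd; apply: FlatMul.
  by move=> x; exact: is_deriveM.
Qed.

Lemma is_derive_continuous (f g : R -> R) :
  (forall x : R, is_derive x 1 f (g x)) -> continuous f.
Proof.
move=> df x; apply: differentiable_continuous; apply/derivable1_diffP.
by case: (df x).
Qed.

Definition tensor (f g : R -> R) (p : R * R) : R := f p.1 * g p.2.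

Lemma continuous_tensor f g : continuous f -> continuous g ->
  continuous (tensor f g).
Proof.
move=> cf cg p; apply: cvgM.
  by apply: (@continuous_comp _ _ _ fst f); [exact: cvg_fst|exact: cf].
by apply: (@continuous_comp _ _ _ snd g); [exact: cvg_snd|exact: cg].
Qed.

Lemma partial_tensor j (f f' g g' : R -> R) :
  (forall x : R, is_derive x 1 f (f' x)) -> (forall x : R, is_derive x 1 g (g' x)) ->
  (forall p, derivable (tensor f g) p (basis_vec j)) /\
  partial j (tensor f g) = if j == 0 then tensor f' g else tensor f g'.
Proof.
move=> df dg.
suff H p : derivable (tensor f g) p (basis_vec j) /\
    partial j (tensor f g) p = (if j == 0 then tensor f' g else tensor f g') p.
  by split=> [p|]; [case: (H p)|apply/funext => p; case: (H p)].
apply: is_derive_line; rewrite /comp/line/coord/tensor.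
case: (j == 0) => /=.
  apply: (is_derive_eq (is_deriveM (df p.1) (is_derive_cst (g p.2) p.1 1))).
  by rewrite scaler0 add0r /GRing.scale/= mulrC.
apply: (is_derive_eq (is_deriveM (is_derive_cst (f p.1) p.2 1) (dg p.2))).
by rewrite scaler0 addr0.
Qed.

(** Every iterated partial derivative of a tensor product is again a tensor
    product of two functions of the algebra. *)
Lemma smooth_tensor f g : flat_algebra f -> flat_algebra g -> smooth (tensor f g).
Proof.
move=> Ff Fg s.
have [f1 [g1 [Ff1 Fg1 ->]]] : exists f1 g1,
    [/\ flat_algebra f1, flat_algebra g1 & foldr partial (tensor f g) s = tensor f1 g1].
  elim: s => [|j s [f1 [g1 [Ff1 Fg1 /= ->]]]]; first by exists f, g.
  have [f2 Ff2 df] := flat_algebra_derive Ff1.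
  have [g2 Fg2 dg] := flat_algebra_derive Fg1.
  rewrite (partial_tensor j df dg).2.
  by case: ifP => _; [exists f2, g1|exists f1, g2].
have [f2 Ff2 df] := flat_algebra_derive Ff1.
have [g2 Fg2 dg] := flat_algebra_derive Fg1.
split; first by apply: continuous_tensor; exact: is_derive_continuous.
by move=> j; exact: (partial_tensor j df dg).1.
Qed.

End smooth_class.

(** * Integrability and square integrability *)

Section almost_everywhere_plane.
Context {R : realType}.
Local Notation plane := (measurableTypeR R * measurableTypeR R)%type.
Implicit Types P Q : plane -> Prop.

(** Stating this on the measurable type [plane] lets the filter instance be
    found for properties whose variable has type [R * R]. *)
Lemma ae_imply P Q : (forall x, P x -> Q x) ->
  {ae @area R, forall x, P x} -> {ae @area R, forall x, Q x}.
Proof. by move=> PQ; apply: filterS. Qed.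

Lemma ae_imply2 P1 P2 Q : (forall x, P1 x -> P2 x -> Q x) ->
  {ae @area R, forall x, P1 x} -> {ae @area R, forall x, P2 x} ->
  {ae @area R, forall x, Q x}.
Proof. by move=> PQ; apply: filterS2. Qed.

End almost_everywhere_plane.

Section square_integrable.
Context d (T : measurableType d) (R : realType) (mu : {measure set T -> \bar R}).
Variables (D : set T) (mD : measurable D).
Implicit Types f g h : T -> R.

Notation integ f := (mu.-integrable D (EFin \o f)).

(** Square integrability on [D] without extension by zero, the form in which
    products and linear combinations are easy to handle. *)
Definition sqint f := measurable_fun D f /\ integ (fun x => f x ^+ 2).

Lemma integ_measurable f : integ f -> measurable_fun D f.
Proof. by move=> /measurable_int /measurable_EFinP. Qed.

Lemma le_integ f g : measurable_fun D f -> (forall x, D x -> `|f x| <= g x) ->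
  integ g -> integ f.
Proof.
move=> mf fg ig; apply: le_integrable ig => //; first exact/measurable_EFinP.
by move=> x Dx /=; rewrite lee_fin (le_trans (fg _ Dx))// ler_norm.
Qed.

Lemma integD f g : integ f -> integ g -> integ (fun x => f x + g x).
Proof. by move=> fi gi; exact: (integrableD mD fi gi). Qed.

Lemma integZ a f : integ f -> integ (fun x => a * f x).
Proof. by move=> fi; exact: (integrableZl mD a fi). Qed.

(** From [|f g| <= f ^ 2 + g ^ 2]. *)
Lemma sqint_mul f g : sqint f -> sqint g -> integ (fun x => f x * g x).
Proof.
move=> [mf f2] [mg g2]; apply: (le_integ _ _ (integD f2 g2)).
  exact: measurable_funM.
move=> x _; rewrite ler_norml; apply/andP.
have := sqr_ge0 (f x); have := sqr_ge0 (g x).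
have := sqr_ge0 (f x + g x); have := sqr_ge0 (f x - g x); split; nra.
Qed.

(** From [|f| <= 1 + f ^ 2]. *)
Lemma sqint_integ f : (mu D < +oo)%E -> sqint f -> integ f.
Proof.
move=> Doo [mf f2]; have i1 : integ (cst 1).
  apply: measurable_bounded_integrable => //.
  by exists 1; split => // M hM x _ /=; rewrite normr1 ltW.
apply: (le_integ mf _ (integD i1 f2)) => x _ /=.
rewrite ler_norml; apply/andP; have := sqr_ge0 (f x - 1); have := sqr_ge0 (f x + 1).
by split; nra.
Qed.

Lemma sqint_lin a b f g : sqint f -> sqint g -> sqint (fun x => a * f x + b * g x).
Proof.
move=> [mf f2] [mg g2].
have m : measurable_fun D (fun x => a * f x + b * g x).
  by apply: measurable_funD; apply: measurable_funM.
split => //; apply: (le_integ _ _ (integD (integZ (2 * a ^+ 2) f2) (integZ (2 * b ^+ 2) g2))).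
  exact: measurable_funX.
move=> x _; rewrite ger0_norm ?sqr_ge0//.
have := sqr_ge0 (a * f x - b * g x); nra.
Qed.

Lemma ae_Rintegral_eq f g : measurable_fun D f -> measurable_fun D g ->
  {ae mu, forall x, D x -> f x = g x} ->
  \int[mu]_(x in D) f x = \int[mu]_(x in D) g x.
Proof.
move=> mf mg fg; rewrite /Rintegral (@ae_eq_integral _ _ _ _ _ (EFin \o g))//.
- exact/measurable_EFinP.
- exact/measurable_EFinP.
- by apply: filterS fg => x fg Dx /=; rewrite fg.
Qed.

Lemma Rintegral_le0_ae0 f : integ f -> (forall x, D x -> 0 <= f x) ->
  \int[mu]_(x in D) f x <= 0 -> {ae mu, forall x, D x -> f x = 0}.
Proof.
move=> fi f0 If; have mf := integ_measurable fi.
have I0 : (\int[mu]_(x in D) `|(f x)%:E| = 0)%E.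
  have -> : (\int[mu]_(x in D) `|(f x)%:E| = \int[mu]_(x in D) (f x)%:E)%E.
    by apply: eq_integral => x /[!inE] Dx; rewrite gee0_abs// lee_fin f0.
  rewrite -[LHS]fineK; last exact: integrable_fin_num.
  congr EFin; apply/eqP; rewrite eq_le [_ <= _]If/=.
  exact: Rintegral_ge0.
have mfE : measurable_fun D (EFin \o f) by exact/measurable_EFinP.
have h := (ae_eq_integral_abs mu mD mfE).1 I0.
by apply: filterS h => x h Dx; have [] := h Dx.
Qed.

Lemma Rintegral0_integral0 f : integ f ->
  \int[mu]_(x in D) f x = 0 -> (\int[mu]_(x in D) (f x)%:E = 0)%E.
Proof.
by move=> fi I0; rewrite -[LHS]fineK; [congr EFin|exact: integrable_fin_num].
Qed.

Lemma Rintegral_lin a b f g : integ f -> integ g ->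
  \int[mu]_(x in D) (a * f x + b * g x) =
  a * \int[mu]_(x in D) f x + b * \int[mu]_(x in D) g x.
Proof.
move=> fi gi; rewrite RintegralD ?RintegralZl//; exact: integZ.
Qed.

End square_integrable.

Section Lp_plane.
Context {R : realType}.
Local Notation plane := (measurableTypeR R * measurableTypeR R)%type.
Local Notation mu := (@area R).
Variables (Omega : set (R * R)) (mO : measurable (Omega : set plane)).

Lemma Lp_on2P (f : R * R -> R) : Lp_on 2%:E Omega f <-> sqint mu Omega f.
Proof.
have E2 : (fun x => ((f \_ Omega) x ^+ 2)) = (fun x => f x ^+ 2) \_ Omega.
  by apply/funext => x; rewrite !patchE; case: ifP => // _; rewrite expr0n.
have iE : mu.-integrable setT (EFin \o (fun x => ((f \_ Omega) x ^+ 2)))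
    <-> mu.-integrable Omega (EFin \o (fun x => f x ^+ 2)).
  rewrite E2 -restrict_EFin; split => [h|h]; first exact/integrable_mkcond.
  exact: (integrable_mkcond _ mO).1 h.
split=> [fL|[mf fi]].
  split; last by apply/iE; exact: Lfun2_integrable_sqr.
  by move: fL; rewrite /Lp_on inE => /andP[/[!inE] /= /(measurable_restrictT f mO).2].
rewrite /Lp_on inE; apply/andP; split; rewrite inE/=.
  exact: (measurable_restrictT f mO).1 mf.
rewrite /finite_norm unlock poweR_lty//.
move/iE : fi => /integrableP[_]; apply: le_lt_trans.
rewrite le_eqVlt; apply/orP; left; apply/eqP.
apply: eq_integral => x _ /=.
by rewrite powR_mulrn// normrX.
Qed.

Lemma Lp_on_inftyP (f : R * R -> R) : Lp_on +oo%E Omega f ->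
  measurable_fun (Omega : set plane) (f : plane -> R) /\
  exists2 C, 0 <= C & {ae mu, forall x, Omega x -> `|f x| <= C}.
Proof.
rewrite /Lp_on inE => /andP[/[!inE]/= mf fL]; split.
  exact: (measurable_restrictT f mO).2 mf.
(* the norm of index [+oo] is an essential supremum only when the measure of
   the whole space is positive *)
have m0 : (0 < mu setT)%E.
  apply: (@lt_le_trans _ _ (mu (`[0%R, 1%R] `*` `[0%R, 1%R]))).
    rewrite /area product_measure1E; [|exact: measurable_itv..].
    have h : (0 < @lebesgue_measure R `[0%R, 1%R])%E.
      by rewrite lebesgue_measure_itv/= lte_fin ltr01 oppr0 adde0.
    by apply: mule_gt0; exact: h.
  by apply: le_measure; rewrite ?inE//; apply: measurableX; exact: measurable_itv.
move: fL; rewrite /finite_norm unlock m0 => fL.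
have := ess_sup_ge mu (abse \o (EFin \o (f \_ Omega))).
have : (0 <= ess_sup mu (abse \o (EFin \o (f \_ Omega))))%E.
  by apply: ess_sup_gee => //; apply: aeW => x /=.
move: fL; case: (ess_sup mu _) => [C| |] // _ C0 h; exists C => //.
by apply: filterS h => x /= + Ox; rewrite patchE mem_set.
Qed.


End Lp_plane.

(** * Integrals over the plane *)

Section box.
Context {R : realType}.
Local Notation plane := (measurableTypeR R * measurableTypeR R)%type.
Local Notation mu := (@area R).

(** The Borel sets over which [g] has zero integral form a Dynkin system
    containing the rectangles, hence they are all the Borel sets. *)
Lemma rect_integral0_ae0 a b c d (g : R * R -> R) :
  mu.-integrable (rect a b c d) (EFin \o g) ->
  (forall a' b' c' d', a <= a' -> b' <= b -> c <= c' -> d' <= d ->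
    (\int[mu]_(x in rect a' b' c' d') (g x)%:E = 0)%E) ->
  {ae mu, forall x, rect a b c d x -> g x = 0}.
Proof.
move=> ig g0.
have mQ := @measurable_rect R a b c d.
have mg : measurable_fun (rect a b c d) (EFin \o g) by exact: measurable_int ig.
have H S : <<s @rects R >> S ->
    (\int[mu]_(x in rect a b c d `&` S) (g x)%:E = 0)%E.
  move: S; apply: dynkin_induction; first exact: measurable_plane.
  - move=> _ _ [a1 [b1 [c1 [d1 ->]]]] [a2 [b2 [c2 [d2 ->]]]].
    by rewrite rectI; do 4 eexists; reflexivity.
  - by rewrite setIT; exact: g0.
  - move=> _ [a1 [b1 [c1 [d1 ->]]]]; rewrite rectI; apply: g0;
      by rewrite ?le_max ?ge_min lexx.
  - move=> S mS IS.
    have := g0 a b c d (lexx _) (lexx _) (lexx _) (lexx _).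
    have := @setUIDK _ (rect a b c d) S => {1}<-.
    rewrite integral_setU//.
    + by rewrite IS add0e setDE.
    + exact: measurableI.
    + exact: measurableD.
    + by rewrite setUIDK.
    + apply/disj_setPS => x [[_ ?] [_ ?]] //.
  - move=> F mF tF IF; rewrite setI_bigcupr integral_bigcup//.
    + by apply: eseries0 => i _ _; exact: IF.
    + exact: trivIset_setIl.
    + by move=> k; exact: measurableI.
    + apply: integrableS ig => //.
        by apply: bigcupT_measurable => k; exact: measurableI.
      by apply: bigcup_sub => k _; exact: subIsetl.
have : ae_eq mu (rect a b c d) (EFin \o g) (cst 0%E).
  apply: integral_ae_eq => // E EQ mE.
  rewrite integral_cst// mul0e -(setIidr EQ); apply: H.
  by rewrite -measurable_plane.
by apply: filterS => x /= h Qx; have [] := h Qx.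
Qed.

Definition box (M : R) : set (R * R) := crect (- M) M (- M) M.

Lemma bounded_sub_box (A : set (R * R)) : bounded_set A -> exists M, A `<=` box M.
Proof.
move=> [M [_ hM]]; exists (M + 1) => x Ax.
have := hM (M + 1) ltac:(by rewrite ltrDl) x Ax.
rewrite /box/crect/= !in_itv/= -!ler_norml => h; split; apply: le_trans h.
  by rewrite prod_normE le_max lexx.
by rewrite prod_normE le_max lexx orbT.
Qed.

Lemma continuous_bounded_on_box (f : R * R -> R) M : continuous f ->
  exists2 C, 0 <= C & forall x, box M x -> `|f x| <= C.
Proof.
move=> cf.
have : compact (f @` box M).
  apply: continuous_compact; last exact: compact_crect.
  exact: continuous_subspaceT.
move=> /compact_bounded[C [_ hC]]; exists (`|C| + 1); first by rewrite addr_ge0.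
move=> x Mx; apply: (hC (`|C| + 1)); last by exists x.
by rewrite (le_lt_trans (ler_norm _))// ltrDl.
Qed.

Lemma integrable_box_supported (f : R * R -> R) M (D : set (R * R)) :
  measurable (D : set plane) -> measurable_fun D (f : plane -> R) ->
  (exists2 C, 0 <= C & forall x, `|f x| <= C) ->
  (forall x, f x != 0 -> box M x) ->
  mu.-integrable D (EFin \o f).
Proof.
move=> mD mf [C C0 fC] fM.
apply: (@le_integrable _ _ _ _ _ mD _ (fun x => C%:E * (\1_(box M) x)%:E)%E).
- exact/measurable_EFinP.
- move=> x Dx; rewrite /= lee_fin indicE.
  have [f0|f0] := eqVneq (f x) 0; first by rewrite f0 normr0.
  by rewrite mem_set ?mulr1; [rewrite (ger0_norm C0)|exact: fM].
- apply: integrableZl => //.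
  apply: (@integrableS _ _ _ _ setT) => //.
  have mB : measurable (box M : set plane) by exact: measurable_crect.
  apply/integrableP; split.
    by apply/measurable_EFinP; exact: measurable_indic.
  under eq_integral do rewrite /= ger0_norm//.
  by rewrite integral_indic// setIT area_crect_lty.
Qed.

Lemma partial_supp j (f : R * R -> R) p :
  partial j f p != 0 -> closure [set x | f x != 0] p.
Proof.
apply: contra_neqP => ncl.
have : nbhs p (~` closure [set x | f x != 0]).
  by apply: open_nbhs_nbhs; split => //; apply: closed_openC; exact: closed_closure.
move=> h; rewrite /partial (@near_eq_derive _ _ _ _ (cst 0)) ?derive_cst//.
apply: filterS h => x hx; apply: contrapT => fx; apply: hx.
by apply: subset_closure; exact/eqP.
Qed.

Lemma continuous_line j (p : R * R) : continuous (line j p).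
Proof.
move=> s; rewrite /line; case: (j == 0).
  exact: (cvg_pair cvg_id (cvg_cst _)).
exact: (cvg_pair (cvg_cst _) cvg_id).
Qed.

Lemma continuous_box_bounded (f : R * R -> R) M : continuous f ->
  (forall x, f x != 0 -> box M x) -> exists2 C, 0 <= C & forall x, `|f x| <= C.
Proof.
move=> cf fM; have [C C0 fC] := continuous_bounded_on_box M cf; exists C => // x.
have [f0|f0] := eqVneq (f x) 0; first by rewrite f0 normr0.
by apply: fC; exact: fM.
Qed.

(** By Fubini it suffices to integrate along the lines in direction [j],
    where the fundamental theorem of calculus gives the difference of two
    values of [h] outside its support. *)
Lemma integral_partial0 j (h : R * R -> R) M : continuous h ->
  (forall p, derivable h p (basis_vec j)) -> continuous (partial j h) ->
  (forall p, h p != 0 -> box M p) ->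
  (\int[mu]_p (partial j h p)%:E = 0)%E.
Proof.
move=> ch dh cdh hM.
have M'M (x : R) N : x \in `[- M, M] -> (M < N) -> x \in `]- N, N[.
  rewrite !in_itv/= => /andP[h1 h2] h3; apply/andP; split; lra.
have dM p : partial j h p != 0 -> box M p.
  move=> /partial_supp; rewrite (closure_id (box M)).1; last exact: closed_crect.
  by apply: closure_subset => x; exact: hM.
have line0 p : (\int[lebesgue_measure]_s (partial j h (line j p s))%:E = 0)%E.
  (* a strictly larger box, so that [h] vanishes at both ends of the segment *)
  pose N : R := `|M| + 1.
  have MN : M < N by rewrite (le_lt_trans (ler_norm _))// ltrDl.
  have N0 : - N < N by rewrite gtrN// ltr_wpDl.
  have hline (f : R * R -> R) s : (forall p, f p != 0 -> box M p) ->
      f (line j p s) != 0 -> s \in `]- N, N[.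
    move=> fM /fM; rewrite /line/box/crect; case: (j == 0) => /= -[h1 h2]; exact: (M'M _ _ _ MN).
  transitivity (\int[lebesgue_measure]_(s in `[(- N)%R, N]) (partial j h (line j p s))%:E)%E.
    rewrite [RHS]integral_mkcond; apply: eq_integral => s _; rewrite patchE.
    case: ifPn => // sN; apply/eqP; rewrite eqe; apply: contraNT sN.
    move=> /hline => /(_ dM) sN; rewrite inE/=; exact: subset_itv_oo_cc.
  have cl := @continuous_line j p.
  have chl : continuous (h \o line j p).
    by move=> s; apply: continuous_comp; [exact: cl|exact: ch].
  have hN s : s \notin `]- N, N[ -> h (line j p s) = 0.
    by move=> sN; apply/eqP; apply: contraNT sN; exact: hline.
  have hl s : h \o line j (line j p s) = h \o line j p.
    by apply/funext => t; rewrite /= line_line.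
  have := @continuous_FTC2 R (fun s => partial j h (line j p s)) (h \o line j p) (- N) N N0.
  move=> -> //=.
  - by rewrite !hN ?subee// in_itv/= ltxx ?andbF.
  - apply: continuous_subspaceT => s.
    by apply: continuous_comp; [exact: cl|exact: cdh].
  - split.
    + move=> s _; have := dh (line j p s); by rewrite derivable_line coord_line hl.
    + by apply: cvg_at_right_filter; exact: chl.
    + by apply: cvg_at_left_filter; exact: chl.
  - by move=> s _; rewrite derive1E partial_line coord_line hl.
have ih : mu.-integrable setT (EFin \o partial j h).
  apply: (@integrable_box_supported _ M) => //.
  - exact: continuous_measurable_plane.
  - exact: continuous_box_bounded dM.
have := line0; rewrite /line; case: (j == 0) => l0.
  rewrite -(integral21_prod_meas1 ih) /fubini_G/=.
  by apply: integral0_eq => y _; exact: (l0 (0, y)).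
rewrite -(integral12_prod_meas1 ih) /fubini_F/=.
by apply: integral0_eq => x _; exact: (l0 (x, 0)).
Qed.

End box.

(** * Test functions and integration by parts *)

Section test_functions.
Context {R : realType}.
Local Notation plane := (measurableTypeR R * measurableTypeR R)%type.
Local Notation mu := (@area R).
Implicit Types (phi psi : R * R -> R) (Omega : set (R * R)).

Lemma partial_lin j (a b : R) phi psi :
  (forall p, derivable phi p (basis_vec j)) ->
  (forall p, derivable psi p (basis_vec j)) ->
  (forall p, derivable (fun x => a * phi x + b * psi x) p (basis_vec j)) /\
  partial j (fun x => a * phi x + b * psi x) =
    (fun x => a * partial j phi x + b * partial j psi x).
Proof.
move=> dphi dpsi.
have E : (fun x => a * phi x + b * psi x) = (a *: phi + b *: psi) by [].
have da p : derivable (a *: phi) p (basis_vec j) by exact: derivableZ.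
have db p : derivable (b *: psi) p (basis_vec j) by exact: derivableZ.
split=> [p|]; first by rewrite E; exact: derivableD.
by apply/funext => p; rewrite /partial E deriveD// !deriveZ.
Qed.

Lemma continuous_mul phi psi : continuous phi -> continuous psi ->
  continuous (fun x => phi x * psi x).
Proof. by move=> cphi cpsi x; apply: cvgM; [exact: cphi|exact: cpsi]. Qed.

Lemma continuous_lin (a b : R) phi psi : continuous phi -> continuous psi ->
  continuous (fun x => a * phi x + b * psi x).
Proof.
move=> cphi cpsi x; apply: cvgD; apply: cvgM;
  by [exact: cvg_cst|exact: cphi|exact: cpsi].
Qed.

Lemma smooth_lin (a b : R) phi psi : smooth phi -> smooth psi ->
  smooth (fun x => a * phi x + b * psi x).
Proof.
move=> sphi spsi.
have E s : foldr partial (fun x => a * phi x + b * psi x) s =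
    (fun x => a * foldr partial phi s x + b * foldr partial psi s x).
  elim: s => //= j s ->.
  by rewrite (partial_lin _ _ ((sphi s).2 j) ((spsi s).2 j)).2.
move=> s; rewrite E; split.
  by apply: continuous_lin; [exact: (sphi s).1|exact: (spsi s).1].
by move=> j; exact: (partial_lin _ _ ((sphi s).2 j) ((spsi s).2 j)).1.
Qed.

Lemma test_function_lin Omega (a b : R) phi psi :
  test_function Omega phi -> test_function Omega psi ->
  test_function Omega (fun x => a * phi x + b * psi x).
Proof.
move=> [sphi cphi phiO] [spsi cpsi psiO].
set K := closure [set x | phi x != 0] `|` closure [set x | psi x != 0].
have cK : compact K by exact: compactU.
have sub : closure [set x | a * phi x + b * psi x != 0] `<=` K.
  have /closure_id -> : closed K.
    by apply: compact_closed => //; exact: norm_hausdorff.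
  apply: closure_subset => x /= h.
  have [phi0|phi0] := eqVneq (phi x) 0; last by left; exact: subset_closure.
  have [psi0|psi0] := eqVneq (psi x) 0; last by right; exact: subset_closure.
  by move: h; rewrite phi0 psi0 !mulr0 addr0 eqxx.
split; first exact: smooth_lin.
  by apply: (subclosed_compact _ cK) => //; exact: closed_closure.
by move=> x /sub [/phiO|/psiO].
Qed.

(** The first-order consequences of being a test function that integration
    by parts and square integrability rely on; a bounding box is easier to use
    than a compact support. *)
Record C1c (Omega : set (R * R)) phi : Prop := {
  C1c_continuous : continuous phi;
  C1c_derivable : forall j p, derivable phi p (basis_vec j);
  C1c_partial : forall j, continuous (partial j phi);
  C1c_supp : exists2 M, forall p, phi p != 0 -> box M p &
                 forall j p, partial j phi p != 0 -> box M p;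
  C1c_out : forall p, ~ Omega p -> phi p = 0 /\ forall j, partial j phi p = 0 }.

Lemma test_function_C1c Omega phi : test_function Omega phi -> C1c Omega phi.
Proof.
move=> [sphi cphi phiO].
have [M suppM] := bounded_sub_box (compact_bounded cphi).
split.
- exact: (sphi [::]).1.
- by move=> j p; exact: (sphi [::]).2.
- by move=> j; exact: (sphi [:: j]).1.
- exists M => [p|j p] phi0; apply: suppM; first exact: subset_closure.
  exact: partial_supp phi0.
- move=> p nOp; split => [|j].
    apply: contra_notP nOp => /eqP phi0; apply: phiO; exact: subset_closure.
  apply: contra_notP nOp => /eqP phi0; apply: phiO; exact: partial_supp phi0.
Qed.

Lemma sqint_box phi M D : measurable (D : set plane) -> continuous phi ->
  (forall p, phi p != 0 -> box M p) -> sqint mu D phi.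
Proof.
move=> mD cphi suppM.
have mphi : measurable_fun D (phi : plane -> R) by exact: continuous_measurable_plane.
split => //; apply: (@integrable_box_supported _ _ M) => //.
- exact: measurable_funX.
- have [C C0 hC] := continuous_box_bounded cphi suppM.
  exists (C ^+ 2); first exact: sqr_ge0.
  by move=> x; rewrite normrX lerXn2r// nnegrE.
- by move=> p; rewrite sqrf_eq0; exact: suppM.
Qed.

Lemma C1c_sqint Omega phi D : measurable (D : set plane) -> C1c Omega phi ->
  sqint mu D phi.
Proof. by move=> mD [? _ _ [M suppM _] _]; exact: (sqint_box mD _ suppM). Qed.

Lemma C1c_sqint_partial Omega phi D j : measurable (D : set plane) ->
  C1c Omega phi -> sqint mu D (partial j phi).
Proof.
by move=> mD [_ _ ? [M _ suppM] _]; exact: (sqint_box mD _ (suppM j)).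
Qed.

(** The product [eta * psi] has bounded support inside [Omega], so its partial
    derivative has zero integral.  The factor [eta] is merely C1 so that it can
    be a test function multiplied by [atan] of a coordinate. *)
Lemma integral_by_parts Omega j (eta psi : R * R -> R) :
  measurable (Omega : set plane) ->
  continuous eta -> (forall p, derivable eta p (basis_vec j)) ->
  continuous (partial j eta) -> C1c Omega psi ->
  \int[mu]_(x in Omega) (eta x * partial j psi x) =
  - \int[mu]_(x in Omega) (partial j eta x * psi x).
Proof.
move=> mO ceta deta cdeta [cpsi dpsi cdpsi [M suppM suppdM] outO].
have ib (f g : R * R -> R) D : measurable (D : set plane) ->
    continuous f -> continuous g ->
    (forall p, g p != 0 -> box M p) -> mu.-integrable D (EFin \o (fun x => f x * g x)).
  move=> mD cf cg gM; have cfg : continuous (fun x => f x * g x).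
    exact: continuous_mul.
  have fgM p : f p * g p != 0 -> box M p by rewrite mulf_eq0 negb_or => /andP[_ /gM].
  apply: (@integrable_box_supported _ _ M) => //.
  - exact: continuous_measurable_plane.
  - exact: continuous_box_bounded cfg fgM.
have i1 := ib _ _ _ mO ceta (cdpsi j) (suppdM j).
have i2 := ib _ _ _ mO cdeta cpsi suppM.
apply/eqP; rewrite -subr_eq0 opprK -RintegralD//.
have E p : derivable (eta * psi) p (basis_vec j) /\
    partial j (eta * psi) p = eta p * partial j psi p + partial j eta p * psi p.
  split; first exact: derivableM.
  by rewrite /partial deriveM// /GRing.scale/= [psi p * _]mulrC.
have dE : partial j (eta * psi) = (fun p => eta p * partial j psi p + partial j eta p * psi p).
  by apply/funext => p; exact: (E p).2.
rewrite Rintegral_mkcond.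
have -> : (fun x => eta x * partial j psi x + partial j eta x * psi x) \_ Omega
   = partial j (eta * psi).
  rewrite dE; apply/funext => x; rewrite patchE; case: ifPn => // /negP xO.
  have [|-> dpsi0] := outO x; first by move=> Ox; apply: xO; rewrite inE.
  by rewrite dpsi0 !mulr0 addr0.
suff I0 : (\int[mu]_p (partial j (eta * psi)%R p)%:E = 0)%E by rewrite /Rintegral I0.
apply: (@integral_partial0 _ _ _ M).
- exact: (continuous_mul ceta cpsi).
- by move=> p; exact: (E p).1.
- rewrite dE => x; apply: cvgD.
    exact: (continuous_mul ceta (cdpsi j)).
  exact: (continuous_mul cdeta cpsi).
- by move=> p; rewrite mulf_eq0 negb_or => /andP[_ /suppM].
Qed.

End test_functions.

(** * The fundamental lemma of the calculus of variations *)

Section bumps.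
Context {R : realType}.
Local Notation plane := (measurableTypeR R * measurableTypeR R)%type.
Local Notation mu := (@area R).

Lemma flat1_itv (t : R) : 0 <= flat 1 t <= 1.
Proof.
rewrite /flat; case: ifPn => t0; last by rewrite lexx ler01.
by rewrite hornerC mul1r expR_ge0/= -expR0 ler_expR oppr_le0 invr_ge0 ltW.
Qed.

Lemma flat1_neq0 (t : R) : flat 1 t != 0 -> 0 < t.
Proof. by rewrite /flat; case: ifP => //; rewrite eqxx. Qed.

(** Dilating [exp (- 1 / t)] gives a smooth approximation, from below, of the
    indicator of the positive half line. *)
Lemma cvg_flat1 (t : R) : 0 < t -> flat 1 (n.+1%:R * t) @[n --> \oo] --> (1 : R).
Proof.
move=> t0.
have -> : (fun n => flat 1 (n.+1%:R * t)) = (fun n => expR (- (harmonic n * t^-1))).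
  by apply/funext => n; rewrite /flat mulr_gt0// hornerC mul1r invfM.
have h : (- (harmonic n * t^-1)) @[n --> \oo] --> (- 0 : R).
  apply: cvgN; rewrite -(mul0r (t^-1)).
  by apply: cvgM; [exact: cvg_harmonic|exact: cvg_cst].
rewrite oppr0 in h; rewrite -expR0.
exact: (continuous_cvg _ (@continuous_expR R 0) h).
Qed.

Definition bump_itv (a b : R) (n : nat) (x : R) : R :=
  flat 1 (n.+1%:R * x + - (n.+1%:R * a)) * flat 1 (- n.+1%:R * x + n.+1%:R * b).

Lemma flat_algebra_bump_itv a b n : flat_algebra (bump_itv a b n).
Proof. by apply: FlatMul; exact: FlatGen. Qed.

Lemma bump_itvE a b n x :
  bump_itv a b n x = flat 1 (n.+1%:R * (x - a)) * flat 1 (n.+1%:R * (b - x)).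
Proof. by rewrite /bump_itv; congr (flat 1 _ * flat 1 _); ring. Qed.

Lemma bump_itv01 a b n x : 0 <= bump_itv a b n x <= 1.
Proof.
have /andP[h1 h2] := flat1_itv (n.+1%:R * (x - a)).
have /andP[h3 h4] := flat1_itv (n.+1%:R * (b - x)).
by rewrite bump_itvE mulr_ge0//= mulr_ile1.
Qed.

Lemma bump_itv_supp a b n x : bump_itv a b n x != 0 -> a < x < b.
Proof.
rewrite bump_itvE mulf_eq0 negb_or => /andP[/flat1_neq0 + /flat1_neq0].
by rewrite !pmulr_rgt0// !subr_gt0 => -> ->.
Qed.

Lemma cvg_bump_itv a b x : bump_itv a b n x @[n --> \oo] --> (\1_`]a, b[ x : R).
Proof.
rewrite indicE; case: (boolP (x \in _)).
  rewrite inE/= in_itv/= => /andP[ax xb].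
  under eq_fun do rewrite bump_itvE.
  rewrite /= -[1%:R]mulr1; apply: cvgM; apply: cvg_flat1; by rewrite subr_gt0.
rewrite notin_setE/= in_itv/= => /negP xab.
rewrite (_ : (fun n => _) = cst 0); first exact: cvg_cst.
by apply/funext => n/=; apply/eqP; apply: contraNT xab; exact: bump_itv_supp.
Qed.

Definition rect_bump a b c d n : R * R -> R := tensor (bump_itv a b n) (bump_itv c d n).

Lemma rect_bump_supp a b c d n p : rect_bump a b c d n p != 0 -> rect a b c d p.
Proof.
rewrite /rect_bump/tensor mulf_eq0 negb_or => /andP[/bump_itv_supp ? /bump_itv_supp ?].
by split; rewrite /= in_itv.
Qed.

Lemma rect_bump_test_function Omega a b c d n :
  crect a b c d `<=` Omega -> test_function Omega (rect_bump a b c d n).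
Proof.
move=> QO.
have sub : closure [set x | rect_bump a b c d n x != 0] `<=` crect a b c d.
  rewrite (closure_id (crect a b c d)).1; last exact: closed_crect.
  by apply: closure_subset => x /rect_bump_supp; exact: rect_sub_crect.
split.
- by apply: smooth_tensor; exact: flat_algebra_bump_itv.
- by apply: (subclosed_compact _ (@compact_crect R a b c d)) => //; exact: closed_closure.
- exact: subset_trans QO.
Qed.

Lemma rect_bump01 a b c d n p : 0 <= rect_bump a b c d n p <= 1.
Proof.
have /andP[h1 h2] := bump_itv01 a b n p.1; have /andP[h3 h4] := bump_itv01 c d n p.2.
by rewrite mulr_ge0//= mulr_ile1.
Qed.

Lemma cvg_rect_bump a b c d p :
  rect_bump a b c d n p @[n --> \oo] --> (\1_(rect a b c d) p : R).
Proof.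
have -> : (\1_(rect a b c d) p : R) = \1_`]a, b[ p.1 * \1_`]c, d[ p.2.
  by rewrite !indicE /rect in_setX; case: (_ \in _); rewrite ?mul1r ?mul0r.
by apply: cvgM; exact: cvg_bump_itv.
Qed.

Variables (Omega : set (R * R)) (oO : open Omega).
Let mO : measurable (Omega : set plane) := open_measurable_plane oO.

(** Testing against bumps that converge to the indicator of a rectangle shows
    that [g] has zero integral over every rectangle whose closure is in
    [Omega]; countably many rational rectangles cover [Omega]. *)
Lemma test_orthogonal_ae0 (g : R * R -> R) : sqint mu Omega g ->
  (forall phi, test_function Omega phi -> \int[mu]_(x in Omega) (g x * phi x) = 0) ->
  {ae mu, forall x, Omega x -> g x = 0}.
Proof.
move=> g2 g0.
have step a b c d : crect a b c d `<=` Omega ->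
    {ae mu, forall x, rect a b c d x -> g x = 0}.
  move=> QO; set Q := crect a b c d in QO.
  have mQ : measurable (Q : set plane) by exact: measurable_crect.
  have [mg ig2] := g2.
  have igQ : mu.-integrable Q (EFin \o g).
    apply: sqint_integ => //; first exact: area_crect_lty.
    by split; [exact: (measurable_funS mO QO mg)|exact: (integrableS mO mQ QO ig2)].
  apply: rect_integral0_ae0.
        by apply: (integrableS mQ (@measurable_rect R a b c d) (@rect_sub_crect R a b c d)).
  move=> a' b' c' d' h1 h2 h3 h4.
  have Q'Q : crect a' b' c' d' `<=` Q := crectS h1 h2 h3 h4.
  have tb n : test_function Omega (rect_bump a' b' c' d' n).
    by apply: rect_bump_test_function; exact: subset_trans QO.
  have In n : (\int[mu]_(x in Q) (g x * rect_bump a' b' c' d' n x)%:E = 0)%E.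
    have := g0 _ (tb n); set F := fun x => g x * rect_bump a' b' c' d' n x => F0.
    have iF : mu.-integrable Omega (EFin \o F).
      apply: sqint_mul => //; exact: (C1c_sqint mO (test_function_C1c (tb n))).
    have /= <- := Rintegral0_integral0 mO iF F0.
    rewrite [LHS]integral_mkcond [RHS]integral_mkcond.
    apply: eq_integral => x _; rewrite !patchE.
    case: ifPn => xQ; first by rewrite ifT// inE; apply: QO; rewrite inE in xQ.
    case: ifPn => // _; rewrite /F.
    suff -> : rect_bump a' b' c' d' n x = 0 by rewrite mulr0.
    apply/eqP; apply: contraNT xQ => /rect_bump_supp /rect_sub_crect xQ'.
    by rewrite inE; exact: Q'Q.
  have mgQ := integ_measurable igQ.
  have [] := @dominated_convergence _ _ _ mu Q mQ
    (fun n x => (g x * rect_bump a' b' c' d' n x)%:E)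
    (fun x => (g x * \1_(rect a' b' c' d') x)%:E) (fun x => `|g x|%:E).
  - move=> n; apply/measurable_EFinP; apply: measurable_funM => //.
    apply: continuous_measurable_plane => //; exact: (C1c_continuous (test_function_C1c (tb n))).
  - apply/measurable_EFinP; apply: measurable_funM => //.
    apply: measurable_indic; exact: measurable_rect.
  - apply: aeW => x _; apply: cvg_EFin; first by apply: nearW.
    by apply: cvgM; [exact: cvg_cst|exact: cvg_rect_bump].
  - exact: (integrable_abse igQ).
  - apply: aeW => x n _ /=; rewrite lee_fin normrM.
    have /andP[k1 k2] := rect_bump01 a' b' c' d' n x.
    by rewrite (ger0_norm k1) ler_piMr.
  move=> _ _; rewrite [X in X @ _ --> _](_ : _ = cst 0%E); last first.
    by apply/funext => n; exact: In.
  move=> /cvg_lim => /(_ (@ereal_hausdorff R)); rewrite lim_cst// => I0.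
  rewrite -[RHS](esym I0).
  rewrite [LHS]integral_mkcond [RHS]integral_mkcond; apply: eq_integral => x _.
  rewrite !patchE indicE; case: ifPn => xr.
    by rewrite ifT ?mulr1// inE; apply: Q'Q; apply: rect_sub_crect; rewrite inE in xr.
  by rewrite mulr0; case: ifP.
(* [ae_foralln] is about sequences: rational rectangles are enumerated through
   [unpickle] *)
have oE := open_bigcup_rat_rect oO.
have stepq (o : option (rat * rat * (rat * rat))) : {ae mu, forall x q, o = Some q ->
    closed_rat_rect q `<=` Omega -> rat_rect q x -> g x = 0}.
  case: o => [q|]; last by apply: aeW.
  have [qO|nqO] := pselect (closed_rat_rect q `<=` Omega).
    by apply: ae_imply (step _ _ _ _ qO) => x h q' [<-] _; exact: h.
  by apply: aeW => x q' [<-].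
have : {ae mu, forall x n q, unpickle n = Some q ->
    closed_rat_rect q `<=` Omega -> rat_rect q x -> g x = 0}.
  by apply: ae_foralln => n; exact: stepq.
apply: ae_imply => x h; rewrite {1}oE => -[q qO qx].
exact: (h (pickle q) q (pickleK q) qO qx).
Qed.

End bumps.

(** * Weak derivatives *)

Section weak_partials.
Context {R : realType}.
Local Notation plane := (measurableTypeR R * measurableTypeR R)%type.
Local Notation mu := (@area R).
Variables (Omega : set (R * R)) (oO : open Omega).
Let mO : measurable (Omega : set plane) := open_measurable_plane oO.
Implicit Types (a b : R) (f g h : R * R -> R).

Lemma L2_weak_partials_lin j a b f1 f2 g1 g2 :
  sqint mu Omega f1 -> sqint mu Omega f2 ->
  L2_weak_partials Omega j f1 g1 -> L2_weak_partials Omega j f2 g2 ->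
  L2_weak_partials Omega j (fun x => a * f1 x + b * f2 x)
    (fun x => a * g1 x + b * g2 x).
Proof.
move=> sf1 sf2 [/(Lp_on2P mO) sg1 wg1] [/(Lp_on2P mO) sg2 wg2]; split.
  by apply/(Lp_on2P mO); exact: sqint_lin.
move=> phi tphi; have Cphi := test_function_C1c tphi.
have sphi := C1c_sqint mO Cphi; have sdphi := C1c_sqint_partial j mO Cphi.
transitivity (a * \int[mu]_(x in Omega) (f1 x * partial j phi x) +
              b * \int[mu]_(x in Omega) (f2 x * partial j phi x)).
  rewrite -Rintegral_lin//; [|exact: sqint_mul..].
  by apply: eq_Rintegral => x _; ring.
rewrite (wg1 _ tphi) (wg2 _ tphi) !mulrN -opprD; congr (- _).
rewrite -Rintegral_lin//; [|exact: sqint_mul..].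
by apply: eq_Rintegral => x _; ring.
Qed.

Lemma L2_weak_partials_unique j f g h :
  L2_weak_partials Omega j f g -> L2_weak_partials Omega j f h ->
  {ae mu, forall x, Omega x -> g x = h x}.
Proof.
move=> [/(Lp_on2P mO) sg wg] [/(Lp_on2P mO) sh wh].
have sd := sqint_lin mO 1 (-1) sg sh.
have : {ae mu, forall x, Omega x -> 1 * g x + (-1) * h x = 0}.
  apply: (test_orthogonal_ae0 oO sd) => phi tphi.
  have sphi := C1c_sqint mO (test_function_C1c tphi).
  transitivity (1 * \int[mu]_(x in Omega) (g x * phi x) +
                (-1) * \int[mu]_(x in Omega) (h x * phi x)).
    rewrite -Rintegral_lin//; [|exact: sqint_mul..].
    by apply: eq_Rintegral => x _; ring.
  have := wg _ tphi; rewrite (wh _ tphi) => /oppr_inj ->.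
  by rewrite mul1r mulN1r subrr.
by apply: ae_imply => x gh Ox; have := gh Ox; rewrite mul1r mulN1r => /subr0_eq.
Qed.

Lemma weak_partialP j f : L2_weak_partials Omega j f !=set0 ->
  L2_weak_partials Omega j f (weak_partial Omega j f).
Proof. by move=> [g Wg]; rewrite /weak_partial; apply: xgetPex; exists g. Qed.

Lemma test_function_weak_partial j phi : test_function Omega phi ->
  L2_weak_partials Omega j phi (partial j phi).
Proof.
move=> /test_function_C1c Cphi; split.
  by apply/(Lp_on2P mO); exact: (C1c_sqint_partial j mO Cphi).
move=> psi /test_function_C1c Cpsi.
apply: integral_by_parts => //; first exact: C1c_continuous Cphi.
  by move=> p; exact: C1c_derivable Cphi j p.
exact: C1c_partial Cphi j.
Qed.

End weak_partials.

(** * The space H1 *)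

Section H1_space.
Context {R : realType}.
Local Notation plane := (measurableTypeR R * measurableTypeR R)%type.
Local Notation mu := (@area R).
Variables (Omega : set (R * R)) (oO : open Omega).
Let mO : measurable (Omega : set plane) := open_measurable_plane oO.
Implicit Types (a b : R) (u v w : R * R -> 'cV[R]_2).

Definition lincomb a u b v : R * R -> 'cV[R]_2 := fun x => a *: u x + b *: v x.

Lemma component_lin i a u b v :
  component i (lincomb a u b v) = (fun x => a * component i u x + b * component i v x).
Proof. by apply/funext => x; rewrite /component/lincomb !mxE. Qed.

Lemma H1_sqint i u : H1 Omega u -> sqint mu Omega (component i u).
Proof. by move=> /(_ i)[/(Lp_on2P mO)]. Qed.

Lemma H1_weak_partial i j u : H1 Omega u ->
  L2_weak_partials Omega j (component i u) (weak_partial Omega j (component i u)).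
Proof. by move=> /(_ i)[_ /(_ j)]; exact: weak_partialP. Qed.

Lemma H1_sqint_partial i j u : H1 Omega u ->
  sqint mu Omega (weak_partial Omega j (component i u)).
Proof. by move=> /(H1_weak_partial i j)[/(Lp_on2P mO)]. Qed.

Lemma H1_lin a u b v : H1 Omega u -> H1 Omega v -> H1 Omega (lincomb a u b v).
Proof.
move=> Hu Hv i; rewrite component_lin; split.
  by apply/(Lp_on2P mO); apply: sqint_lin => //; exact: H1_sqint.
move=> j; eexists; apply: (L2_weak_partials_lin oO);
  by [exact: H1_sqint|exact: H1_weak_partial].
Qed.

Lemma ae_forall2 (P : 'I_2 -> plane -> Prop) :
  (forall i, {ae mu, forall x, P i x}) -> {ae mu, forall x i, P i x}.
Proof.
move=> h; apply: ae_imply2 (h ord0) (h ord_max) => x P0 P1 i.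
by have [->|->] : i = ord0 \/ i = ord_max by
  case: i => [[|[|//]]] ?; [left|right]; exact: val_inj.
Qed.

(** Only almost everywhere, since [wgrad] picks an arbitrary representative
    of each weak derivative. *)
Lemma wgrad_lin a u b v : H1 Omega u -> H1 Omega v ->
  {ae mu, forall x, Omega x ->
    wgrad Omega (lincomb a u b v) x = a *: wgrad Omega u x + b *: wgrad Omega v x}.
Proof.
move=> Hu Hv.
have : {ae mu, forall x i j, Omega x ->
    weak_partial Omega j (component i (lincomb a u b v)) x =
    a * weak_partial Omega j (component i u) x +
    b * weak_partial Omega j (component i v) x}.
  apply: ae_forall2 => i; apply: ae_forall2 => j.
  apply: (L2_weak_partials_unique oO (H1_weak_partial i j (H1_lin a b Hu Hv))).
  rewrite component_lin.
  by apply: (L2_weak_partials_lin oO); by [exact: H1_sqint|exact: H1_weak_partial].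
apply: ae_imply => x h Ox; apply/matrixP => i j.
by rewrite !mxE h.
Qed.

Lemma test_H1 u : (forall i, test_function Omega (component i u)) -> H1 Omega u.
Proof.
move=> tu i; split.
  by apply/(Lp_on2P mO); exact: C1c_sqint (test_function_C1c (tu i)).
by move=> j; exists (partial j (component i u)); exact: test_function_weak_partial.
Qed.

Lemma wgrad_test u : (forall i, test_function Omega (component i u)) ->
  {ae mu, forall x, Omega x ->
    wgrad Omega u x = \matrix_(i < 2, j < 2) partial j (component i u) x}.
Proof.
move=> tu.
have : {ae mu, forall x i j, Omega x ->
    weak_partial Omega j (component i u) x = partial j (component i u) x}.
  apply: ae_forall2 => i; apply: ae_forall2 => j.
  apply: (L2_weak_partials_unique oO (H1_weak_partial i j (test_H1 tu))).
  exact: test_function_weak_partial.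
by apply: ae_imply => x h Ox; apply/matrixP => i j; rewrite !mxE h.
Qed.

Section frob2.
Context {m n : nat}.
Implicit Types A B : 'M[R]_(m, n).

Lemma frob2_ge0 A : 0 <= frob2 A.
Proof. by apply: sumr_ge0 => i _; apply: sumr_ge0 => j _; exact: sqr_ge0. Qed.

Lemma frob2_lin_le a b A B :
  frob2 (a *: A + b *: B) <= 2 * a ^+ 2 * frob2 A + 2 * b ^+ 2 * frob2 B.
Proof.
rewrite /frob2 !mulr_sumr -big_split; apply: ler_sum => i _.
rewrite !mulr_sumr -big_split; apply: ler_sum => j _ /=.
rewrite !mxE; have := sqr_ge0 (a * A i j - b * B i j); nra.
Qed.

Lemma frob2_entry A i j : A i j ^+ 2 <= frob2 A.
Proof.
rewrite /frob2 (bigD1 i)//= (bigD1 j)//= -addrA lerDl addr_ge0//.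
  by apply: sumr_ge0 => k _; exact: sqr_ge0.
by apply: sumr_ge0 => k _; apply: sumr_ge0 => l _; exact: sqr_ge0.
Qed.

Lemma frob2_eq0 A : frob2 A = 0 -> A = 0.
Proof.
move=> A0; apply/matrixP => i j; rewrite mxE; apply/eqP; rewrite -sqrf_eq0.
by rewrite eq_le sqr_ge0 andbT -A0 frob2_entry.
Qed.

Lemma integ_sum (I : Type) (r : seq I) (F : I -> plane -> R) :
  (forall i, mu.-integrable Omega (EFin \o F i)) ->
  mu.-integrable Omega (EFin \o (fun x => \sum_(i <- r) F i x)).
Proof.
move=> iF; elim: r => [|i r IH].
  under eq_fun do rewrite big_nil.
  exact: integrable0.
under eq_fun do rewrite big_cons.
exact: (integD mO (iF i) IH).
Qed.

Lemma integ_frob2 (A : plane -> 'M[R]_(m, n)) :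
  (forall i j, sqint mu Omega (fun x => A x i j)) ->
  mu.-integrable Omega (EFin \o (fun x => frob2 (A x))).
Proof. by move=> sA; do 2 (apply: integ_sum => ?); exact: (sA _ _).2. Qed.

End frob2.

End H1_space.

(** * The space H10 *)

Section H10_space.
Context {R : realType}.
Local Notation plane := (measurableTypeR R * measurableTypeR R)%type.
Local Notation mu := (@area R).
Variables (Omega : set (R * R)) (oO : open Omega).
Let mO : measurable (Omega : set plane) := open_measurable_plane oO.
Implicit Types (a b : R) (u v w : R * R -> 'cV[R]_2).

Lemma sqint_value u (i : 'I_2) (j : 'I_1) : H1 Omega u ->
  sqint mu Omega (fun x => u x i j).
Proof. by move=> Hu; rewrite (ord1 j); exact: H1_sqint. Qed.

Lemma sqint_wgrad u i j : H1 Omega u -> sqint mu Omega (fun x => wgrad Omega u x i j).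
Proof.
move=> Hu; under eq_fun do rewrite mxE; exact: H1_sqint_partial.
Qed.

Lemma sqint_lin_mx m n a b (A B : plane -> 'M[R]_(m, n)) i j :
  (forall i j, sqint mu Omega (fun x => A x i j)) ->
  (forall i j, sqint mu Omega (fun x => B x i j)) ->
  sqint mu Omega (fun x => (a *: A x + b *: B x) i j).
Proof.
by move=> sA sB; under eq_fun do rewrite !mxE; exact: sqint_lin.
Qed.

Definition H1sq u : R := \int[mu]_(x in Omega) (frob2 (u x) + frob2 (wgrad Omega u x)).

Lemma integ_H1sq u : H1 Omega u ->
  mu.-integrable Omega (EFin \o (fun x => frob2 (u x) + frob2 (wgrad Omega u x))).
Proof.
move=> Hu; apply: integD => //; apply: integ_frob2 => // i j.
  exact: sqint_value.
exact: sqint_wgrad.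
Qed.

Lemma H1norm_lt u (e : R) : 0 < e -> (H1norm Omega u < e) = (H1sq u < e ^+ 2).
Proof.
move=> e0; rewrite /H1norm -/(H1sq u).
have I0 : 0 <= H1sq u by apply: Rintegral_ge0 => x _; rewrite addr_ge0// frob2_ge0.
by rewrite -[in RHS](sqr_sqrtr I0) ltr_pXn2r// nnegrE ?sqrtr_ge0// ltW.
Qed.

(** A substitute for the triangle inequality of the norm of [H1], obtained
    pointwise from [(x + y) ^ 2 <= 2 x ^ 2 + 2 y ^ 2]. *)
Lemma H1sq_lin a b u v : H1 Omega u -> H1 Omega v ->
  H1sq (lincomb a u b v) <= 2 * a ^+ 2 * H1sq u + 2 * b ^+ 2 * H1sq v.
Proof.
move=> Hu Hv; rewrite -Rintegral_lin//; [|exact: integ_H1sq..].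
have iu := integ_H1sq Hu; have iv := integ_H1sq Hv.
have il : mu.-integrable Omega (EFin \o (fun x => frob2 (lincomb a u b v x) +
    frob2 (a *: wgrad Omega u x + b *: wgrad Omega v x))).
  apply: integD => //; apply: integ_frob2 => // i j; apply: sqint_lin_mx => k l;
    by [exact: sqint_value|exact: sqint_wgrad].
rewrite /H1sq (@ae_Rintegral_eq _ _ _ _ _ mO _ (fun x => frob2 (lincomb a u b v x) +
    frob2 (a *: wgrad Omega u x + b *: wgrad Omega v x))).
- apply: le_Rintegral => //; first by apply: integD => //; exact: integZ.
  move=> x _; rewrite !mulrDr addrACA lerD//; exact: frob2_lin_le.
- exact: (integ_measurable (integ_H1sq (H1_lin oO a b Hu Hv))).
- exact: integ_measurable il.
- by apply: ae_imply (wgrad_lin oO a b Hu Hv) => x h Ox; rewrite h.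
Qed.

Lemma small_radius a b e : 0 < e ->
  exists2 r, 0 < r & 2 * a ^+ 2 * r ^+ 2 + 2 * b ^+ 2 * r ^+ 2 < e ^+ 2.
Proof.
move=> e0; have s0 : 0 < `|a| + `|b| + 1 by rewrite ltr_wpDl// addr_ge0.
set s := _ + 1 in s0.
have r0 : 0 < e / (2 * s) by rewrite divr_gt0// mulr_gt0.
exists (e / (2 * s)) => //.
have rE : e = e / (2 * s) * (2 * s) by rewrite divfK// mulf_neq0 ?pnatr_eq0// gt_eqF.
move: (e / (2 * s)) r0 rE => r r0 ->.
rewrite -mulrDl [ltLHS]mulrC exprMn ltr_pM2l ?exprn_gt0//.
rewrite -(real_normK (num_real a)) -(real_normK (num_real b)) /s.
have := normr_ge0 a; have := normr_ge0 b; nra.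
Qed.

Lemma H10_lin a b u v : H10 Omega u -> H10 Omega v -> H10 Omega (lincomb a u b v).
Proof.
move=> [Hu du] [Hv dv]; split; first exact: H1_lin.
move=> e e0.
have [r r0 rab] := small_radius a b e0.
have [phi [tphi phie]] := du _ r0; have [psi [tpsi psie]] := dv _ r0.
exists (lincomb a phi b psi); split.
  by move=> i; rewrite component_lin; exact: test_function_lin.
have Hphi := test_H1 oO tphi; have Hpsi := test_H1 oO tpsi.
have subE u' v' : (fun x => u' x - v' x) = lincomb 1 u' (-1) v' :> (R * R -> 'cV[R]_2).
  by apply/funext => x; rewrite /lincomb scale1r scaleN1r.
have -> : (fun x => lincomb a u b v x - lincomb a phi b psi x) =
    lincomb a (fun x => u x - phi x) b (fun x => v x - psi x).
  by apply/funext => x; rewrite /lincomb !scalerBr opprD addrACA.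
rewrite (H1norm_lt _ r0) in phie; rewrite (H1norm_lt _ r0) in psie.
have Hd1 : H1 Omega (fun x => u x - phi x) by rewrite subE; exact: H1_lin.
have Hd2 : H1 Omega (fun x => v x - psi x) by rewrite subE; exact: H1_lin.
rewrite (H1norm_lt _ e0); apply: le_lt_trans (H1sq_lin a b Hd1 Hd2) _.
have sq0 c : 0 <= 2 * c ^+ 2 :> R by rewrite mulr_ge0// sqr_ge0.
apply: le_lt_trans (lerD _ _) rab.
  exact: (ler_wpM2l (sq0 a) (ltW phie)).
exact: (ler_wpM2l (sq0 b) (ltW psie)).
Qed.

Lemma partial_atan :
  let A := tensor (@atan R) (cst 1) in
  [/\ continuous A, forall p, derivable A p (basis_vec 0),
      partial 0 A = (fun p => (1 + p.1 ^+ 2)^-1) &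
      continuous (partial 0 A)].
Proof.
move=> A.
have c1 : continuous (cst 1 : R -> R) by move=> x; exact: cvg_cst.
have [dA pA] := partial_tensor 0 (@is_derive1_atan R) (fun x => is_derive_cst (1 : R) x 1).
have pA' : partial 0 A = (fun p => (1 + p.1 ^+ 2)^-1).
  by rewrite pA/=; apply/funext => p; rewrite /tensor mulr1.
split => //.
  by apply: continuous_tensor => // x; exact: continuous_atan.
rewrite pA' => p; apply: cvgV.
  by rewrite gt_eqF// ltr_wpDr// sqr_ge0.
apply: cvgD; first exact: cvg_cst.
by apply: (@continuous_comp _ _ _ fst (fun x : R => x ^+ 2));
  [exact: cvg_fst|exact: exprn_continuous].
Qed.

(** Integrating [(phi * atan) * phi] by parts along the first coordinate: the
    derivative [1 / (1 + x ^ 2)] of [atan] is positive and [atan] is bounded by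
    [pi / 2], so the weighted norm of [phi] is controlled by the product of the
    norms of [phi] and of its derivative; [e] is the parameter of Young's
    inequality. *)
Lemma test_weighted_bound phi (e : R) : test_function Omega phi -> 0 < e ->
  \int[mu]_(x in Omega) ((1 + x.1 ^+ 2)^-1 * phi x ^+ 2) <=
  pi * (e * \int[mu]_(x in Omega) (phi x ^+ 2)
        + e^-1 * \int[mu]_(x in Omega) (partial 0 phi x ^+ 2)).
Proof.
move=> /test_function_C1c Cphi e0.
have [cA dA pA cpA] := partial_atan; set A := tensor _ _ in cA dA pA cpA.
have [cphi /(_ 0) dphi /(_ 0) cdphi _ _] := Cphi.
have [m1 i1] := C1c_sqint mO Cphi; have [m2 i2] := C1c_sqint_partial 0 mO Cphi.
have mA := continuous_measurable_plane mO cA.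
have mpA := continuous_measurable_plane mO cpA.
have Abd p : `|A p| <= pi / 2.
  by rewrite /A/tensor mulr1 ler_norml !ltW ?atan_gtNpi2 ?atan_ltpi2.
have eA : partial 0 (fun p => phi p * A p) =
    (fun p => phi p * partial 0 A p + A p * partial 0 phi p).
  by apply/funext => p; rewrite /partial (deriveM (dphi p) (dA p)).
have := @integral_by_parts _ Omega 0 (fun p => phi p * A p) phi mO
  (continuous_mul cphi cA) (fun p => derivableM (dphi p) (dA p)) _ Cphi.
rewrite eA => /(_ _)/wrap[].
  move=> x; apply: cvgD.
    exact: (continuous_mul cphi cpA).
  exact: (continuous_mul cA cdphi).
have pi0 := @pi_gt0 R.
have i12 := sqint_mul mO (conj m1 i1) (conj m2 i2).
have i3 : mu.-integrable Omega (EFin \o (fun x => A x * (phi x * partial 0 phi x))).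
  apply: (le_integ mO _ _ (integZ mO (pi / 2) (integD mO i1 i2))).
    by apply: measurable_funM => //; exact: measurable_funM.
  move=> x _; rewrite normrM ler_pM//.
  rewrite ler_norml; apply/andP.
  have := sqr_ge0 (phi x - partial 0 phi x); have := sqr_ge0 (phi x + partial 0 phi x).
  have := sqr_ge0 (phi x); have := sqr_ge0 (partial 0 phi x).
  split; nra.
have i4 : mu.-integrable Omega (EFin \o (fun x => partial 0 A x * phi x ^+ 2)).
  apply: (le_integ mO _ _ i1).
    by apply: measurable_funM => //; exact: measurable_funX.
  move=> x _; rewrite normrM normrX real_normK ?num_real// ler_piMl ?sqr_ge0//.
  rewrite pA ger0_norm ?invr_ge0 ?addr_ge0 ?sqr_ge0//.
  by rewrite invf_le1 ?lerDl ?ltr_wpDr ?sqr_ge0.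
move=> H.
have E0 : \int[mu]_(x in Omega) (1 * (partial 0 A x * phi x ^+ 2)
      + 2 * (A x * (phi x * partial 0 phi x))) = 0.
  rewrite Rintegral_lin// mul1r.
  move: H.
  rewrite (_ : \int[mu]_(x in Omega) (phi x * A x * partial 0 phi x) =
    \int[mu]_(x in Omega) (A x * (phi x * partial 0 phi x))); last first.
    by apply: eq_Rintegral => x _; ring.
  rewrite (_ : \int[mu]_(x in Omega) ((phi x * partial 0 A x + A x * partial 0 phi x) * phi x) =
     \int[mu]_(x in Omega) (1 * (partial 0 A x * phi x ^+ 2) +
       1 * (A x * (phi x * partial 0 phi x)))); last first.
    by apply: eq_Rintegral => x _; ring.
  rewrite Rintegral_lin// !mul1r; lra.
have -> : \int[mu]_(x in Omega) ((1 + x.1 ^+ 2)^-1 * phi x ^+ 2) =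
          \int[mu]_(x in Omega) (partial 0 A x * phi x ^+ 2) by rewrite pA.
rewrite -Rintegral_lin// -RintegralZl//; last by apply: integD => //; exact: integZ.
rewrite -[leRHS]addr0 -E0 -RintegralD//; last 2 first.
- by apply: integZ => //; apply: integD => //; exact: integZ.
- by apply: integD => //; exact: integZ.
apply: le_Rintegral => //.
  by apply: integD => //; [apply: integZ => //|]; apply: integD => //; exact: integZ.
move=> x _.
rewrite mul1r [leRHS]addrC -addrA lerDl.
have h : `|2 * (A x * (phi x * partial 0 phi x))| <= pi * `|phi x * partial 0 phi x|.
  rewrite !normrM mulrA (ger0_norm (ler0n _ 2)) -normrM ler_wpM2r//.
  by rewrite mulrC -ler_pdivlMr//; exact: Abd.
have h2 : `|phi x * partial 0 phi x| <= e * phi x ^+ 2 + e^-1 * partial 0 phi x ^+ 2.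
  have -> : e * phi x ^+ 2 + e^-1 * partial 0 phi x ^+ 2 =
     e^-1 * ((e * phi x) ^+ 2 + partial 0 phi x ^+ 2) by field; rewrite gt_eqF.
  rewrite ler_pdivlMl// -{1}(ger0_norm (ltW e0)) -normrM mulrA ler_norml; apply/andP.
  set y := e * phi x; set z := partial 0 phi x.
  have := sqr_ge0 y; have := sqr_ge0 z.
  have := sqr_ge0 (y - z); have := sqr_ge0 (y + z).
  split; nra.
have := le_trans h (ler_wpM2l (ltW pi0) h2).
by rewrite ler_norml => /andP[+ _]; lra.
Qed.

(** If [phi] is at distance at most [e] from [w] then its first partial
    derivative has norm at most [e], and [test_weighted_bound] with parameter
    [e] bounds the weighted norm of [w] by a multiple of [e]. *)
Lemma H10_wgrad0_ae0 w : H10 Omega w ->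
  {ae mu, forall x, Omega x -> wgrad Omega w x = 0} ->
  {ae mu, forall x, Omega x -> w x = 0}.
Proof.
move=> [Hw dw] gw0.
suff H i : {ae mu, forall x, Omega x -> component i w x = 0}.
  have := ae_forall2 H; apply: ae_imply => x h Ox.
  by apply/matrixP => i j; rewrite (ord1 j) mxE; exact: h.
have sw := H1_sqint oO i Hw; have [mw iw] := sw.
pose rho := fun x : R * R => (1 + x.1 ^+ 2)^-1.
have rho0 x : 0 < rho x by rewrite invr_gt0 ltr_wpDr// sqr_ge0.
have rho1 x : rho x <= 1 by rewrite invf_le1 ?lerDl ?ltr_wpDr ?sqr_ge0.
have mrho : measurable_fun (Omega : set plane) rho.
  have [_ _ pE c] := partial_atan; rewrite pE in c.
  exact: continuous_measurable_plane mO c.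
have irho f : sqint mu Omega f -> mu.-integrable Omega (EFin \o (fun x => rho x * f x ^+ 2)).
  move=> [mf jf]; apply: (le_integ mO _ _ jf).
    by apply: measurable_funM => //; exact: measurable_funX.
  move=> x _; have f20 := sqr_ge0 (f x).
  rewrite ger0_norm; last by apply: mulr_ge0 => //; exact: ltW.
  by rewrite ler_piMl.
set X := \int[mu]_(x in Omega) (rho x * component i w x ^+ 2).
pose W := \int[mu]_(x in Omega) (component i w x ^+ 2).
have W0 : 0 <= W by rewrite /W; apply: Rintegral_ge0 => y _; exact: sqr_ge0.
have pi0 := @pi_gt0 R.
pose K := 2 * pi * (2 * W + 3) + 2.
have piW : 0 <= pi * W by apply: mulr_ge0 => //; exact: ltW.
have K0 : 0 < K by rewrite /K; lra.
(* letting [e] tend to zero then gives [X <= 0] *)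
suff XK e : 0 < e -> e <= 1 -> X <= e * K.
  have X0 : X <= 0.
    rewrite leNgt; apply/negP => X0.
    have e0 : 0 < Num.min 1 (X / (2 * K)) by rewrite lt_min ltr01 divr_gt0// mulr_gt0.
    have := XK _ e0 ltac:(by rewrite ge_min lexx).
    have : Num.min 1 (X / (2 * K)) * K <= X / (2 * K) * K.
      by rewrite ler_wpM2r ?(ltW K0)// ge_min lexx orbT.
    have -> : X / (2 * K) * K = X / 2 by field; rewrite gt_eqF.
    lra.
  have := Rintegral_le0_ae0 mO (irho _ sw) _ X0.
  move=> /(_ _)/wrap[|h].
    by move=> x _; rewrite mulr_ge0 ?sqr_ge0// ltW.
  apply: ae_imply h => x h Ox; apply/eqP; rewrite -sqrf_eq0.
  by have /eqP := h Ox; rewrite mulf_eq0 gt_eqF.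
move=> e0 e1.
have [phi [tphi phie]] := dw _ e0; rewrite (H1norm_lt _ e0) in phie.
have Hphi := test_H1 oO tphi.
have subE : (fun x => w x - phi x) = lincomb 1 w (-1) phi.
  by apply/funext => x; rewrite /lincomb scale1r scaleN1r.
have Hd : H1 Omega (fun x => w x - phi x) by rewrite subE; exact: H1_lin.
set f := component i phi.
have sf : sqint mu Omega f := H1_sqint oO i Hphi.
have sdf : sqint mu Omega (partial 0 f) := C1c_sqint_partial 0 mO (test_function_C1c (tphi i)).
have swf := sqint_lin mO 1 (-1) sw sf.
have isum := integD mO swf.2 sdf.2.
have small : \int[mu]_(x in Omega) ((1 * component i w x + (-1) * f x) ^+ 2 + partial 0 f x ^+ 2)
    <= e ^+ 2.
  apply: le_trans (ltW phie).
  have gE : {ae mu, forall x, Omega x -> wgrad Omega (fun x => w x - phi x) x i 0 = - partial 0 f x}.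
    have gl : {ae mu, forall x, Omega x ->
        wgrad Omega (fun x => w x - phi x) x = (-1) *: wgrad Omega phi x}.
      rewrite subE; apply: ae_imply2 (wgrad_lin oO 1 (-1) Hw Hphi) gw0.
      by move=> x h1 h2 Ox; rewrite h1// h2// scaler0 add0r.
    apply: ae_imply2 gl (wgrad_test oO tphi).
    by move=> x h1 h2 Ox; rewrite h1// h2// !mxE mulN1r.
  have iH := integ_H1sq Hd.
  have mg := sqint_wgrad i 0 Hd.
  have id := integD mO (sqint_value i 0 Hd).2 mg.2.
  rewrite (@ae_Rintegral_eq _ _ _ _ _ mO _
     (fun x => (w x - phi x) i 0 ^+ 2 + wgrad Omega (fun x => w x - phi x) x i 0 ^+ 2)).
  - apply: le_Rintegral => // x _; apply: lerD; exact: frob2_entry.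
  - exact: integ_measurable isum.
  - exact: integ_measurable id.
  - apply: ae_imply gE => x h Ox; rewrite h// sqrrN; congr (_ ^+ 2 + _).
    by rewrite !mxE mul1r mulN1r.
have split_small := small; rewrite RintegralD// in split_small; last 2 first.
- exact: swf.2.
- exact: sdf.2.
set I1 := (\int[mu]_(x in Omega) (1 * component i w x + (-1) * f x) ^+ 2) in split_small.
set I2 := (\int[mu]_(x in Omega) (partial 0 f x ^+ 2)) in split_small.
have I10 : 0 <= I1 by apply: Rintegral_ge0 => x _; exact: sqr_ge0.
have I20 : 0 <= I2 by apply: Rintegral_ge0 => x _; exact: sqr_ge0.
have fW : \int[mu]_(x in Omega) (f x ^+ 2) <= 2 * W + 2 * I1.
  rewrite -Rintegral_lin//; [|exact: swf.2].
  apply: le_Rintegral => //; [exact: sf.2|by apply: integD => //; apply: integZ => //; exact: swf.2|].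
  move=> x _; have := sqr_ge0 (2 * component i w x - f x); lra.
have Xf : X <= 2 * \int[mu]_(x in Omega) (rho x * f x ^+ 2) + 2 * I1.
  rewrite -Rintegral_lin//; [|exact: irho|exact: swf.2].
  apply: le_Rintegral => //; [exact: irho| |].
    by apply: integD => //; apply: integZ => //; [exact: irho|exact: swf.2].
  move=> x _; set y := component i w x; set z := f x.
  apply: (@le_trans _ _ (rho x * (2 * z ^+ 2 + 2 * (1 * y + -1 * z) ^+ 2))).
    rewrite ler_wpM2l ?(ltW (rho0 _))//; have := sqr_ge0 (2 * z - y); lra.
  rewrite mulrDr; apply: lerD; first by rewrite mulrCA.
  by rewrite ler_piMl// mulr_ge0// sqr_ge0.
have Bf := test_weighted_bound (tphi i) e0; rewrite -/f -/I2 in Bf.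
have e2 : e ^+ 2 <= e by rewrite expr2 ler_piMl// ltW.
have B2 : e * \int[mu]_(x in Omega) (f x ^+ 2) + e^-1 * I2 <= e * (2 * W + 3).
  have : e^-1 * I2 <= e by rewrite ler_pdivrMl// -expr2; lra.
  have : e * \int[mu]_(x in Omega) (f x ^+ 2) <= e * (2 * W + 2).
    by rewrite ler_wpM2l ?(ltW e0)//; lra.
  lra.
have := ler_wpM2l (ltW pi0) B2; rewrite /K.
rewrite -/rho in Bf; lra.
Qed.

End H10_space.

(** * The energy as a quadratic form *)

Lemma det_mx22 (S : comPzRingType) (M : 'M[S]_2) :
  \det M = M 0 0 * M 1 1 - M 0 1 * M 1 0.
Proof.
rewrite (expand_det_row _ ord0) big_ord_recl big_ord1 /cofactor !det_mx11 !mxE/=.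
rewrite expr0 expr1 mul1r mulN1r mulrN; congr (_ * M _ _ - M _ _ * M _ _);
  exact: val_inj.
Qed.

Section energy.
Context {R : realType}.
Local Notation plane := (measurableTypeR R * measurableTypeR R)%type.
Local Notation mu := (@area R).
Variables (Omega : set (R * R)) (oO : open Omega).
Let mO : measurable (Omega : set plane) := open_measurable_plane oO.
Variables (f : R * R -> R) (hf : Lp_on +oo%E Omega f).
Implicit Types (a b : R) (u v w : R * R -> 'cV[R]_2) (A B : plane -> 'M[R]_2).

Lemma integ_mul_bounded (h : plane -> R) : mu.-integrable Omega (EFin \o h) ->
  mu.-integrable Omega (EFin \o (fun x => f x * h x)).
Proof.
move=> ih; have [mf [C C0 fC]] := Lp_on_inftyP mO hf.
have mh := integ_measurable ih.
have mfh : measurable_fun Omega (fun x => f x * h x) by exact: measurable_funM.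
have iCh := integZ mO C (integrable_norm ih).
apply/integrableP; split; first exact/measurable_EFinP.
move/integrableP: iCh => [mCh]; apply: le_lt_trans.
apply: ae_ge0_le_integral => //.
- by apply: measurableT_comp => //; exact/measurable_EFinP.
- exact: measurableT_comp.
- apply: ae_imply fC => x fx Ox; rewrite /= lee_fin !normrM normr_id (ger0_norm C0).
  by rewrite ler_wpM2r// fx.
Qed.

Definition sqint_field A := forall i j, sqint mu Omega (fun x => A x i j).

Lemma integ_det A : sqint_field A -> mu.-integrable Omega (EFin \o (fun x => \det (A x))).
Proof.
move=> sA; under eq_fun do rewrite det_mx22.
rewrite (_ : (fun x => _) = fun x => A x 0 0 * A x 1 1 + (-1) * (A x 0 1 * A x 1 0)).
  by apply: integD => //; [|apply: integZ => //]; apply: sqint_mul => //; exact: sA.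
by apply/funext => x; rewrite mulN1r.
Qed.

Definition density (x : R * R) (M : 'M[R]_2) : R := frob2 M + f x * \det M.

Lemma integ_density A : sqint_field A ->
  mu.-integrable Omega (EFin \o (fun x => density x (A x))).
Proof.
move=> sA; apply: integD => //; first exact: integ_frob2.
by apply: integ_mul_bounded; exact: integ_det.
Qed.

(** The integrand of the energy of a combination only involves the gradients
    of the two maps, so identities between quadratic forms on matrices
    can be integrated. *)
Lemma energyF_lin a b u v : H1 Omega u -> H1 Omega v ->
  energyF Omega f (lincomb a u b v) =
  \int[mu]_(x in Omega) density x (a *: wgrad Omega u x + b *: wgrad Omega v x).
Proof.
move=> Hu Hv; apply: ae_Rintegral_eq => //.
- by apply: integ_measurable; apply: integ_density => i j;
    apply: sqint_wgrad => //; exact: H1_lin.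
- by apply: integ_measurable; apply: integ_density => i j;
    apply: sqint_lin_mx => // *; exact: sqint_wgrad.
- by apply: ae_imply (wgrad_lin oO a b Hu Hv) => x h Ox; rewrite h.
Qed.

Lemma density_parallelogram x (M N : 'M[R]_2) :
  density x (2^-1 *: M + 2^-1 *: N) + density x (2^-1 *: M + (- 2^-1) *: N) =
  2^-1 * density x M + 2^-1 * density x N.
Proof.
rewrite /density /frob2 !det_mx22 !big_ord_recl !big_ord0 !mxE.
by field.
Qed.

Lemma energyF_parallelogram u v : H1 Omega u -> H1 Omega v ->
  energyF Omega f (lincomb 2^-1 u 2^-1 v) + energyF Omega f (lincomb 2^-1 u (- 2^-1) v) =
  2^-1 * energyF Omega f u + 2^-1 * energyF Omega f v.
Proof.
move=> Hu Hv.
have su : sqint_field (wgrad Omega u) by move=> i j; exact: sqint_wgrad.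
have sv : sqint_field (wgrad Omega v) by move=> i j; exact: sqint_wgrad.
have sl a b : sqint_field (fun x => a *: wgrad Omega u x + b *: wgrad Omega v x).
  by move=> i j; exact: sqint_lin_mx.
rewrite !energyF_lin// -RintegralD//; [|exact: integ_density (sl _ _)..].
rewrite -Rintegral_lin//; [|exact: integ_density..].
by apply: eq_Rintegral => x _; exact: density_parallelogram.
Qed.

Lemma integ_f_det u : H1 Omega u ->
  mu.-integrable Omega (EFin \o (fun x => f x * \det (wgrad Omega u x))).
Proof.
move=> Hu; have su : sqint_field (wgrad Omega u) by move=> i j; exact: sqint_wgrad.
exact: integ_mul_bounded (integ_det su).
Qed.

Lemma energyF_dirichlet u : H1 Omega u -> energyF Omega f u =
  dirichlet Omega u + \int[mu]_(x in Omega) (f x * \det (wgrad Omega u x)).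
Proof.
move=> Hu; rewrite /energyF /dirichlet RintegralD//; last exact: integ_f_det.
by apply: integ_frob2 => // i j; exact: sqint_wgrad.
Qed.

(** The determinant term depends only on the prescribed determinant, so
    it cancels. *)
Lemma energyF_sub_dirichlet u v : H1 Omega u -> H1 Omega v ->
  {ae mu, forall x, Omega x -> \det (wgrad Omega v x) = \det (wgrad Omega u x)} ->
  energyF Omega f v - energyF Omega f u = dirichlet Omega v - dirichlet Omega u.
Proof.
move=> Hu Hv uv.
have cancel (x y z : R) : x + z - (y + z) = x - y by ring.
have mfu := integ_measurable (integ_f_det Hu).
have mfv := integ_measurable (integ_f_det Hv).
have E : \int[mu]_(x in Omega) (f x * \det (wgrad Omega v x)) =
         \int[mu]_(x in Omega) (f x * \det (wgrad Omega u x)).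
  apply: (ae_Rintegral_eq mO mfv mfu).
  by apply: ae_imply uv => x h Ox; rewrite h.
rewrite (energyF_dirichlet Hv) E (energyF_dirichlet Hu).
exact: cancel.
Qed.

End energy.

(** * Minimizers of the energy minimize the Dirichlet integral *)

Theorem theorem3p1 (R : realType) (Omega : set (R * R)) (f : R * R -> R)
    (u0 u : R * R -> 'cV[R]_2)
    (hOmega : domain Omega)
    (hf : Lp_on +oo%E Omega f)
    (hu0 : H1 Omega u0)
    (hgamma : exists2 gamma : R, 0 < gamma &
       forall phi, H10 Omega phi ->
         gamma * \int[area]_(x in Omega) frob2 (wgrad Omega phi x)
         <= energyF Omega f phi)
    (hu : minimizes (energyF Omega f) (H1bc Omega u0) u) :
  let A_g := prescribed_det Omega u0 (fun x => \det (wgrad Omega u x)) in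
  minimizes (dirichlet Omega) A_g u /\
  forall v, minimizes (dirichlet Omega) A_g v ->
    {ae area, forall x, Omega x -> v x = u x}.
Proof.
move=> A_g.
(* these facts are proved about variables because [lra] compares its atoms up
   to conversion, which is expensive for integrals *)
have halves (x y p q : R) :
    x + y = 2^-1 * p + 2^-1 * q -> p <= q -> q <= x -> y <= 0 by lra.
have sub_ge (a b c d : R) : a - b = c - d -> c <= d -> a <= b by lra.
have sub_le (a b c d : R) : a - b = c - d -> b <= a -> d <= c by lra.
have [_ oO _] := hOmega.
have [[Hu du] umin] := hu.
have Agu : A_g u by split; [split|apply: aeW].
have dirichlet_min : minimizes (dirichlet Omega) A_g u.
  split=> [|v [[Hv dv] uv]]; first exact: Agu.
  exact: sub_le (energyF_sub_dirichlet oO hf Hu Hv uv) (umin v (conj Hv dv)).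
split=> [|v [Agv vmin]]; first exact: dirichlet_min.
have [[Hv dv] uv] := Agv.
have Fvu : energyF Omega f v <= energyF Omega f u.
  exact: sub_ge (energyF_sub_dirichlet oO hf Hu Hv uv) (vmin u Agu).
have mean_admissible : H1bc Omega u0 (lincomb 2^-1 v 2^-1 u).
  split; first exact: H1_lin.
  rewrite (_ : (fun x => _) =
    lincomb 2^-1 (fun x => v x - u0 x) 2^-1 (fun x => u x - u0 x)).
    exact: H10_lin.
  apply/funext => x; rewrite /lincomb !scalerBr addrACA -opprD -scalerDl.
  by rewrite (_ : 2^-1 + 2^-1 = 1 :> R) ?scale1r//; field.
have H10diff : H10 Omega (lincomb 2^-1 v (- 2^-1) u).
  rewrite (_ : lincomb _ _ _ _ =
    lincomb 2^-1 (fun x => v x - u0 x) (- 2^-1) (fun x => u x - u0 x)).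
    exact: H10_lin.
  by apply/funext => x; rewrite /lincomb !scalerBr !scaleNr opprK addrACA addNr addr0.
set w := lincomb _ _ _ _ in H10diff.
have Fw : energyF Omega f w <= 0.
  exact: halves (energyF_parallelogram oO hf Hv Hu) Fvu (umin _ mean_admissible).
have [gamma gamma0 coercive] := hgamma.
have Dw : \int[area]_(x in Omega) frob2 (wgrad Omega w x) <= 0.
  by rewrite -(pmulr_rle0 _ gamma0); exact: le_trans (coercive _ H10diff) Fw.
have Hw : H1 Omega w by exact: H1_lin.
have gw0 : {ae area, forall x, Omega x -> wgrad Omega w x = 0}.
  have iw := integ_frob2 oO (fun i j => sqint_wgrad oO i j Hw).
  have := Rintegral_le0_ae0 (open_measurable_plane oO) iw (fun x _ => frob2_ge0 _) Dw.
  by apply: ae_imply => x h Ox; apply: frob2_eq0; exact: h.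
apply: ae_imply (H10_wgrad0_ae0 oO H10diff gw0) => x h Ox.
have /eqP := h Ox; rewrite /w /lincomb scaleNr -scalerBr scaler_eq0 invr_eq0 pnatr_eq0/=.
by rewrite subr_eq0 => /eqP.
Qed.
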